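(* Let $f$ be a quasi-homogeneous polynomial on $\mathbb{K}^2$ of degree $d$ with respect to the weights $(\omega_1,\omega_2)$, whose germ at $0$ is of finite codimension $c$, and let $\Pi_0=f\,\frac{\partial}{\partial x}\wedge\frac{\partial}{\partial y}$. Let $\{e_1,\dots,e_r\}$ be a basis of the vector space of quasi-homogeneous polynomials of degree $d-\omega_1-\omega_2$ (with $0$ included), and let $\{u_1,\dots,u_c\}$ be a monomial basis of $Q_f=\mathcal{F}(\mathbb{K}^2)/I_f$. Then the family $\{[e_1f]_{\Pi_0},\dots,[e_rf]_{\Pi_0},[u_1]_{\Pi_0},\dots,[u_c]_{\Pi_0}\}$ is a basis of $H^2(f)$. In particular, $H^2(\Pi_0)$ is a finite-dimensional vector space of dimension $r+c$.
   Context: $\mathbb{K}=\mathbb{R}$ or $\mathbb{C}$. $\mathcal{F}(\mathbb{K}^2)$, $\mathcal{X}(\mathbb{K}^2)$, $\mathcal{V}(\mathbb{K}^2)$ are the spaces of germs at $(0,0)$ of functions, vector fields and 2-vectors (bivector fields) on $\mathbb{K}^2$, in one fixed category: holomorphic if $\mathbb{K}=\mathbb{C}$; real analytic or $C^\infty$ if $\mathbb{K}=\mathbb{R}$. Fix positive integers $\omega_1,\omega_2$ and put $W=\omega_1x\frac{\partial}{\partial x}+\omega_2y\frac{\partial}{\partial y}$. A polynomial $g$ is quasi-homogeneous of degree $k\in\mathbb{Z}$ if $W.g=kg$ ($0$ is included when forming the vector space of such polynomials, which is $\{0\}$, so $r=0$, if $k$ is not the quasi-degree of any monomial). $X.g$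 is the derivative of $g$ along $X$; for $X=A\frac{\partial}{\partial x}+B\frac{\partial}{\partial y}$, $\operatorname{div}X=\frac{\partial A}{\partial x}+\frac{\partial B}{\partial y}$. $I_f$ is the ideal of $\mathcal{F}(\mathbb{K}^2)$ generated by $\frac{\partial f}{\partial x},\frac{\partial f}{\partial y}$; $f$ is of finite codimension $c$ if $\dim_{\mathbb{K}}\mathcal{F}(\mathbb{K}^2)/I_f=c<\infty$. A monomial basis of $Q_f$ means monomials $u_1,\dots,u_c$ in $x,y$ whose classes form a basis of $Q_f$. For $F\in\mathcal{F}(\mathbb{K}^2)$ put $B^2(F)=\{X.F-(\operatorname{div}X)F : X\in\mathcal{X}(\mathbb{K}^2)\}$ and $H^2(F)=\mathcal{F}(\mathbb{K}^2)/B^2(F)$. For $\Pi=F\frac{\partial}{\partial x}\wedge\frac{\partial}{\partial y}$, the second (germified) Poisson cohomology space is $H^2(\Pi)=\mathcal{V}(\mathbb{K}^2)/\{[X,\Pi]:X\in\mathcal{X}(\mathbb{K}^2)\}$, where $[X,\Pi]=(X.F-(\operatorname{div}X)F)\frac{\partial}{\partial x}\wedge\frac{\partial}{\partial y}$ is the Schouten bracket; it is isomorphic to $H^2(F)$. For $g\in\mathcal{F}(\mathbb{K}^2)$, $[g]_{\Pi_0}$ is its class in $H^2(f)$. *)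

(* Defs.v *)
From HB Require Import structures.
From mathcomp Require Import all_boot all_order all_algebra.
From mathcomp Require Import all_classical all_reals all_analysis.
From mathcomp Require Import complex.
From mathcomp Require mpoly.
(* Importing the notations of mpoly would clash with those of analysis. *)
Import (canonicals, coercions) mpoly.

Set Implicit Arguments.
Unset Strict Implicit.
Unset Printing Implicit Defensive.

Import Order.TTheory GRing.Theory Num.Theory.
Import numFieldNormedType.Exports.

Local Open Scope classical_set_scope.
Local Open Scope ring_scope.
Local Open Scope quotient_scope.

Section Quotients.
Variables (K : pzRingType) (V : lmodType K).
Implicit Types S T : set V.

(* For T a subspace of S: the classes of the v i form a basis of the vector
   space S / T, i.e. they lie in S, are linearly independent modulo T and
   generate S modulo T. *)
Definition quot_basis S T n (v : 'I_n -> V) : Prop :=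
  [/\ forall i, S (v i),
      forall a : 'I_n -> K, T (\sum_i a i *: v i) -> forall i, a i = 0
    & forall g, S g -> exists a : 'I_n -> K, T (g - \sum_i a i *: v i)].

Definition quot_dim S T n : Prop := exists v : 'I_n -> V, quot_basis S T v.

Definition is_basis S n (v : 'I_n -> V) : Prop := quot_basis S [set 0] v.

End Quotients.

Section Functions.
Variable K : numFieldType.
Implicit Types (f : K * K -> K) (U : set (K * K)).

Definition dx f : K * K -> K := fun p => derive1 (fun t : K => f (t, p.2)) p.1.
Definition dy f : K * K -> K := fun p => derive1 (fun t : K => f (p.1, t)) p.2.

Fixpoint Ck (k : nat) U f : Prop :=
  (forall p, U p -> {for p, continuous f}) /\
  (if k is k'.+1 then
     [/\ forall p, U p -> derivable (fun t : K => f (t, p.2)) p.1 1,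
         forall p, U p -> derivable (fun t : K => f (p.1, t)) p.2 1,
         Ck k' U (dx f) & Ck k' U (dy f)]
   else True).

Definition smooth0 f : Prop :=
  exists2 U, open_nbhs (0 : K * K) U & forall k, Ck k U f.

(* f is, on a bidisc around (0, 0), the sum of an absolutely convergent power
   series. *)
Definition analytic0 f : Prop :=
  exists (a : nat -> nat -> K) (rho : K), 0 < rho /\
    forall p : K * K, `|p.1| < rho -> `|p.2| < rho ->
      (exists M : K, forall n : nat,
         \sum_(i < n) \sum_(j < n) `|a i j * p.1 ^+ i * p.2 ^+ j| <= M) /\
      (fun n : nat => \sum_(i < n) \sum_(j < n) a i j * p.1 ^+ i * p.2 ^+ j)
        @ \oo --> f p.

End Functions.

Section Germs.
Variable K : numFieldType.

Definition null_germ : {pred (K * K -> K)} :=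
  fun f => `[< \forall p \near (0 : K * K), f p = 0 >].

Lemma null_germ_closed : idealr_closed null_germ.
Proof.
split.
- by apply/asboolP; near=> p.
- by apply/asboolP => /nbhs_singleton /eqP; rewrite /= oner_eq0.
- move=> a u v /asboolP u0 /asboolP v0; apply/asboolP; near=> p.
  have -> : (a * u + v) p = a p * u p + v p by [].
  have -> : u p = 0 by near: p.
  by have -> : v p = 0 by [near: p]; rewrite mulr0 addr0.
Unshelve. all: by end_near. Qed.

HB.instance Definition _ := isIdealr.Build _ null_germ null_germ_closed.

(* Germs at (0, 0) of arbitrary functions; the regular ones are singled out by
   [regular_germs] below. *)
Definition germ : Type := {ideal_quot null_germ}.
HB.instance Definition _ := GRing.ComNzRing.on germ.

Definition germ_of (f : K * K -> K) : germ := \pi_{ideal_quot null_germ} f.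

Lemma germ_ofP f g :
  germ_of f = germ_of g <-> \forall p \near (0 : K * K), f p = g p.
Proof.
rewrite /germ_of; split.
- move/eqP; rewrite -Quotient.idealrBE => /asboolP; apply: filterS => p.
  by move/eqP; rewrite -[X in X == _]/(f p - g p) subr_eq0 => /eqP.
- move=> fg; apply/eqP; rewrite -Quotient.idealrBE; apply/asboolP.
  by apply: filterS fg => p fg; rewrite -[LHS]/(f p - g p) fg subrr.
Qed.

Definition ddx (g : germ) : germ := germ_of (dx (repr g)).
Definition ddy (g : germ) : germ := germ_of (dy (repr g)).

Lemma repr_germ_of f : \forall p \near (0 : K * K), repr (germ_of f) p = f p.
Proof. by apply/germ_ofP; rewrite /germ_of reprK. Qed.

Lemma ddx_germ_of f : ddx (germ_of f) = germ_of (dx f).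
Proof.
apply/germ_ofP; move/nbhs_interior: (repr_germ_of f).
apply: filterS => -[x y] [[/= A B] [nA nB] AB].
rewrite /dx /= !derive1E; apply: near_eq_derive; apply: filterS nA => t At.
by apply: (AB (t, y)); split => //; exact: nbhs_singleton.
Qed.

Lemma ddy_germ_of f : ddy (germ_of f) = germ_of (dy f).
Proof.
apply/germ_ofP; move/nbhs_interior: (repr_germ_of f).
apply: filterS => -[x y] [[/= A B] [nA nB] AB].
rewrite /dy /= !derive1E; apply: near_eq_derive; apply: filterS nB => t Bt.
by apply: (AB (x, t)); split => //; exact: nbhs_singleton.
Qed.

Let cst_germ (a : K) : germ := germ_of (fun=> a).

Let cst_germM a b : cst_germ (a * b) = cst_germ a * cst_germ b.
Proof. exact: (rmorphM (\pi_{ideal_quot null_germ})). Qed.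

Let cst_germD a b : cst_germ (a + b) = cst_germ a + cst_germ b.
Proof. exact: (raddfD (\pi_{ideal_quot null_germ})). Qed.

Let cst_germ1 : cst_germ 1 = 1.
Proof. exact: (rmorph1 (\pi_{ideal_quot null_germ})). Qed.

Let scale_germ (a : K) (g : germ) : germ := cst_germ a * g.

Let scale_germA a b g : scale_germ a (scale_germ b g) = scale_germ (a * b) g.
Proof. by rewrite /scale_germ cst_germM mulrA. Qed.

Let scale_germ1 : left_id 1 scale_germ.
Proof. by move=> g; rewrite /scale_germ cst_germ1 mul1r. Qed.

Let scale_germDr : right_distributive scale_germ +%R.
Proof. by move=> a g h; rewrite /scale_germ mulrDr. Qed.

Let scale_germDl g : {morph scale_germ^~ g : a b / a + b}.
Proof. by move=> a b; rewrite /scale_germ cst_germD mulrDl. Qed.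

HB.instance Definition _ := GRing.Zmodule_isLmodule.Build K germ
  scale_germA scale_germ1 scale_germDr scale_germDl.

(* A germ of vector field A d/dx + B d/dy is the pair (A, B). *)
Definition action (X : germ * germ) (g : germ) : germ :=
  X.1 * ddx g + X.2 * ddy g.

Definition divergence (X : germ * germ) : germ := ddx X.1 + ddy X.2.

(* A germ of 2-vector h d/dx /\ d/dy is represented by its coefficient h. *)
Definition bivector : Type := germ.
HB.instance Definition _ := GRing.Lmodule.on bivector.

Definition wedge (h : germ) : bivector := h.
Definition coef (P : bivector) : germ := P.

Definition schouten (X : germ * germ) (P : bivector) : bivector :=
  wedge (action X (coef P) - divergence X * coef P).

End Germs.

Section Polynomials.
Variable K : numFieldType.

Local Notation poly2 := (mpoly.mpoly 2 K).

Definition poly_germ (g : poly2) : germ K :=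
  germ_of (fun p : K * K =>
    mpoly.meval (fun i : 'I_2 => if i == ord0 then p.1 else p.2) g).

Definition monomial (m : mpoly.multinom 2) : poly2 := mpoly.mpolyX K m.

(* W.g, for W = w1 x d/dx + w2 y d/dy *)
Definition euler (w1 w2 : nat) (g : poly2) : poly2 :=
  w1%:R *: (monomial (mpoly.mnm1 ord0) * mpoly.mderiv ord0 g) +
  w2%:R *: (monomial (mpoly.mnm1 ord_max) * mpoly.mderiv ord_max g).

Definition quasi_homogeneous (w1 w2 : nat) (k : int) : set poly2 :=
  [set g | euler w1 w2 g = k%:~R *: g].

End Polynomials.

(* Holomorphic and real analytic germs are the sums of convergent power series,
   over R[i] and R respectively; smooth means C^infinity over R. *)
Variant category := Holomorphic | RealAnalytic | Smooth.

Definition base (R : realType) (C : category) : numFieldType :=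
  match C with Holomorphic => R[i] | RealAnalytic | Smooth => R end.

Section RegularGerms.
Variables (R : realType) (C : category).
Local Notation K := (base R C).

Definition regular (f : K * K -> K) : Prop :=
  match C with
  | Holomorphic | RealAnalytic => analytic0 f
  | Smooth => smooth0 f
  end.

Definition regular_germs : set (germ K) := @germ_of K @` regular.

Definition vector_fields : set (germ K * germ K) :=
  regular_germs `*` regular_germs.

Definition bivectors : set (bivector K) := @wedge K @` regular_germs.

Definition jacobian_ideal (f : germ K) : set (germ K) :=
  [set a * ddx f + b * ddy f | a in regular_germs & b in regular_germs].

Definition has_codim (f : germ K) (c : nat) : Prop :=
  quot_dim regular_germs (jacobian_ideal f) c.

Definition B2 (F : germ K) : set (germ K) :=
  [set action X F - divergence X * F | X in vector_fields].

Definition coboundaries2 (P : bivector K) : set (bivector K) :=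
  [set schouten X P | X in vector_fields].

End RegularGerms.

Arguments regular {R} C f.
Arguments regular_germs R C : clear implicits.
Arguments vector_fields R C : clear implicits.
Arguments bivectors R C : clear implicits.
Arguments jacobian_ideal {R} C f.
Arguments has_codim {R} C f c.
Arguments B2 {R} C F.
Arguments coboundaries2 {R} C P.

(* Main.v *)
(* Write W for the weighted Euler field, so that W.f = d f, and k = d - w1 - w2.
   Since d <> 0, f lies in its Jacobian ideal I_f, hence B^2(f) is contained in
   I_f, and X.f = (div X) f modulo B^2(f), so that g |-> g f maps the germs onto
   I_f / B^2(f).  Taking X = h W shows that (W.h - k h) f is in B^2(f).  Every
   germ is P + W.h - k h with P quasi-homogeneous of degree k, so the e_i f span
   I_f / B^2(f).  Conversely, if P f = X.f - (div X) f with P quasi-homogeneous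
   of degree k, then X may be replaced by its weighted component of weight k,
   and X - ((P + div X) / d) W is a polynomial field that annihilates f.  As a
   power of x and a power of y lie in I_f, it is a constant multiple of the
   Hamiltonian field of f, which is divergence free, and this forces P = 0.
   The category matters only for Hadamard's lemma and for inverting W + n + 1 on
   germs: division of Taylor coefficients in the analytic case, and
   h(x, y) = \int_0^1 t^n f(t^w1 x, t^w2 y) dt in the smooth case. *)
Require Import Defs.
From HB Require Import structures.
From mathcomp Require Import all_boot all_order all_algebra.
From mathcomp Require Import all_classical all_reals all_analysis.
From mathcomp Require Import complex.
From mathcomp Require Import ring lra zify.
From mathcomp Require mpoly.
Import (canonicals, coercions) mpoly.

Set Implicit Arguments.
Unset Strict Implicit.
Unset Printing Implicit Defensive.

Import Order.TTheory GRing.Theory Num.Theory.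
Import numFieldNormedType.Exports.

Local Open Scope classical_set_scope.
Local Open Scope ring_scope.
Local Open Scope quotient_scope.

(** * Weighted homogeneous polynomials *)

(** A smooth germ is not the sum of its weighted components. Arguments about components are
    therefore carried out on polynomials: germs are replaced by Taylor polynomials up to an error in
    a high power of the maximal ideal, and since both weights are at least 1, such an error has no
    component of the weight under study. What remains is an exact polynomial identity, the same in
    all three categories. Finite codimension is exploited in this way too: a monomial heavier than
    every basis monomial is a combination of the partials of f with polynomial coefficients. The
    resulting powers of x and y stand in for the coprimality of the two partials, and they exclude d
    = 0, where f would be constant. Independence is proved in two stages: modulo I_f only the basis
    monomials survive, so their coefficients vanish first, and the e_i f are then treated alone. *)

Section WeightedPolynomials.
Variable K : numFieldType.
Variables w1 w2 : nat.

Local Notation poly2 := (mpoly.mpoly 2 K).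
Local Notation coeff := mpoly.mcoeff.
Local Notation Dx := (mpoly.mderiv (ord0 : 'I_2)).
Local Notation Dy := (mpoly.mderiv (ord_max : 'I_2)).
Local Notation Xm := (mpoly.mpolyX K).
Local Notation PX := (monomial K (mpoly.mnm1 (ord0 : 'I_2))).
Local Notation PY := (monomial K (mpoly.mnm1 (ord_max : 'I_2))).
Implicit Types (p q f g : poly2) (m : mpoly.multinom 2) (n k d : int).

Lemma ord2P (i : 'I_2) : i = ord0 \/ i = ord_max.
Proof. by case: i => [[|[|//]]] ?; [left|right]; apply: val_inj. Qed.

Lemma multinom2P m1 m2 : m1 ord0 = m2 ord0 -> m1 ord_max = m2 ord_max -> m1 = m2.
Proof. by move=> h0 h1; apply/mpoly.mnmP => i; case: (ord2P i) => ->. Qed.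

(** Integer valued because it is compared with degrees such as d - w1 - w2, which can be
    negative. *)
Definition weight m : int := (w1 * m ord0 + w2 * m ord_max)%:Z.

Lemma weightD m1 m2 : weight (mpoly.mnm_add m1 m2) = weight m1 + weight m2.
Proof. by rewrite /weight !mpoly.mnmDE; lia. Qed.

Lemma weight_mnm1 i : weight (mpoly.mnm1 i) = (if i == ord0 then w1 else w2)%:Z.
Proof.
by rewrite /weight !mpoly.mnm1E; case: (ord2P i) => -> /=; rewrite !(muln0, muln1) ?addn0.
Qed.

Definition whomog n p := forall m, coeff m p != 0 -> weight m = n.

Lemma coeff_monomialM i p m : (0 < m i)%N ->
  coeff m (monomial K (mpoly.mnm1 i) * p) = coeff (mpoly.mnm_sub m (mpoly.mnm1 i)) p.
Proof.
move=> mi; rewrite mulrC /monomial.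
rewrite -[in LHS](@mpoly.submK _ (mpoly.mnm1 i) m); last by rewrite mpoly.lep1mP -lt0n.
by rewrite mpoly.addmC mpoly.mcoeffMX.
Qed.

Lemma coeff_monomialM0 i p m : m i = 0%N ->
  coeff m (monomial K (mpoly.mnm1 i) * p) = 0.
Proof.
move=> mi; apply/eqP; rewrite mpoly.mcoeff_eq0; apply/negP.
rewrite mulrC /monomial (perm_mem (mpoly.msuppMX _ _)) => /mapP[m' _ E].
by move: mi; rewrite E mpoly.mnmDE mpoly.mnm1E eqxx.
Qed.

Lemma coeff_monomial_deriv i p m :
  coeff m (monomial K (mpoly.mnm1 i) * mpoly.mderiv i p) = (m i)%:R * coeff m p.
Proof.
have [mi|mi] := posnP (m i); first by rewrite coeff_monomialM0 // mi mul0r.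
have le1 : mpoly.lem (mpoly.mnm1 i) m by rewrite mpoly.lep1mP -lt0n.
rewrite coeff_monomialM // mpoly.mcoeff_deriv mpoly.submK //.
by rewrite mpoly.mnmBE mpoly.mnm1E eqxx subn1 prednK // mulr_natl.
Qed.

Lemma coeff_euler p m : coeff m (euler w1 w2 p) = (weight m)%:~R * coeff m p.
Proof.
rewrite /euler linearD /= !mpoly.mcoeffZ !coeff_monomial_deriv /weight.
by rewrite !mulrA -mulrDl -pmulrn natrD !natrM.
Qed.

(** W is diagonal on monomials with the weight as eigenvalue, and characteristic zero lets the
    eigenvalue in K determine the integer weight. *)
Lemma quasi_homogeneousP n p : quasi_homogeneous w1 w2 n p <-> whomog n p.
Proof.
split=> [E m nz|h].
- have := congr1 (coeff m) E; rewrite coeff_euler mpoly.mcoeffZ.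
  by move/(mulIf nz)/intr_inj.
- apply/mpoly.mpolyP => m; rewrite coeff_euler mpoly.mcoeffZ.
  by have [->|/h ->//] := eqVneq (coeff m p) 0; rewrite !mulr0.
Qed.

Lemma whomogD n p q : whomog n p -> whomog n q -> whomog n (p + q).
Proof.
move=> hp hq m; rewrite mpoly.mcoeffD.
by have [->|/hp//] := eqVneq (coeff m p) 0; rewrite add0r => /hq.
Qed.

Lemma whomogZ n c p : whomog n p -> whomog n (c *: p).
Proof. by move=> hp m; rewrite mpoly.mcoeffZ mulf_eq0 negb_or => /andP[_ /hp]. Qed.

Lemma whomogN n p : whomog n p -> whomog n (- p).
Proof. by rewrite -scaleN1r; exact: whomogZ. Qed.

Lemma whomogB n p q : whomog n p -> whomog n q -> whomog n (p - q).
Proof. by move=> hp hq; apply: whomogD => //; exact: whomogN. Qed.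

Lemma whomogM n k p q : whomog n p -> whomog k q -> whomog (n + k) (p * q).
Proof.
move=> hp hq m; rewrite -mpoly.mcoeff_msupp => /mpoly.msuppM_le /allpairsP[[m1 m2] /=].
case; rewrite !mpoly.mcoeff_msupp => /hp h1 /hq h2 ->.
by rewrite weightD h1 h2.
Qed.

Lemma whomog_monomial m : whomog (weight m) (monomial K m).
Proof.
move=> m'; rewrite /monomial mpoly.mcoeffX; have [->//|] := eqVneq m m'.
by rewrite eqxx.
Qed.

Lemma whomog_deriv i n p : whomog (n + (if i == ord0 then w1 else w2)%:Z) p ->
  whomog n (mpoly.mderiv i p).
Proof.
move=> hp m; rewrite mpoly.mcoeff_deriv mulrn_eq0 /= => /hp.
by rewrite weightD weight_mnm1 => /addIr.
Qed.

Definition wcomp n p : poly2 :=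
  \sum_(m <- mpoly.msupp p | weight m == n) coeff m p *: Xm m.

Lemma coeff_wcomp n p m :
  coeff m (wcomp n p) = if weight m == n then coeff m p else 0.
Proof.
rewrite /wcomp linear_sum /=.
under eq_bigr do rewrite mpoly.mcoeffZ mpoly.mcoeffX.
case: ifPn => [/eqP wm|wm]; last first.
  rewrite big1 // => m' /eqP wm'; have [E|] := eqVneq m' m; last by rewrite mulr0.
  by move: wm; rewrite -E wm' eqxx.
rewrite [in RHS](mpoly.mpolyE p) linear_sum /= big_mkcond /=; apply: eq_bigr => m' _.
rewrite mpoly.mcoeffZ mpoly.mcoeffX; case: ifPn => // wm'.
have [E|] := eqVneq m' m; last by rewrite mulr0.
by move: wm'; rewrite E wm eqxx.
Qed.

Lemma wcompD n p q : wcomp n (p + q) = wcomp n p + wcomp n q.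
Proof.
apply/mpoly.mpolyP => m; rewrite mpoly.mcoeffD !coeff_wcomp mpoly.mcoeffD.
by case: ifP; rewrite ?addr0.
Qed.

Lemma wcompZ n c p : wcomp n (c *: p) = c *: wcomp n p.
Proof.
apply/mpoly.mpolyP => m; rewrite mpoly.mcoeffZ !coeff_wcomp mpoly.mcoeffZ.
by case: ifP; rewrite ?mulr0.
Qed.

Lemma wcomp0 n : wcomp n 0 = 0.
Proof. by have := wcompZ n 0 0; rewrite !scale0r. Qed.

Lemma wcompN n p : wcomp n (- p) = - wcomp n p.
Proof. by rewrite -scaleN1r wcompZ scaleN1r. Qed.

Lemma wcompB n p q : wcomp n (p - q) = wcomp n p - wcomp n q.
Proof. by rewrite wcompD wcompN. Qed.

Lemma whomog_wcomp n p : whomog n (wcomp n p).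
Proof. by move=> m; rewrite coeff_wcomp; case: (weight m =P n); rewrite ?eqxx. Qed.

Lemma wcomp_whomog n k p : whomog k p -> wcomp n p = if n == k then p else 0.
Proof.
move=> hp; apply/mpoly.mpolyP => m; rewrite coeff_wcomp.
have [E|nz] := eqVneq (coeff m p) 0.
  by case: ifP; case: ifP; rewrite ?E ?mpoly.mcoeff0.
by rewrite (hp _ nz) eq_sym; case: ifP; rewrite ?mpoly.mcoeff0.
Qed.

Lemma wcomp_id n p : whomog n p -> wcomp n p = p.
Proof. by move/(wcomp_whomog n) => ->; rewrite eqxx. Qed.

(** By linearity in [p] it suffices to test monomials. This is how components are extracted from
    products with f and its partials. *)
Lemma wcompM n d p f : whomog d f -> wcomp n (p * f) = wcomp (n - d) p * f.
Proof.
move=> hf; elim/mpoly.mpolyind: p => [|c m p _ _ IH].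
  by rewrite mul0r !wcomp0 mul0r.
rewrite mulrDl !wcompD IH mulrDl -scalerAl !wcompZ -scalerAl; congr (c *: _ + _).
have hm := @whomog_monomial m.
rewrite (wcomp_whomog n (whomogM hm hf)) (wcomp_whomog _ hm).
by rewrite subr_eq; case: ifP; rewrite ?mul0r.
Qed.

Lemma wcomp_deriv i n p :
  wcomp n (mpoly.mderiv i p) = mpoly.mderiv i (wcomp (n + (if i == ord0 then w1 else w2)%:Z) p).
Proof.
apply/mpoly.mpolyP => m; rewrite coeff_wcomp !mpoly.mcoeff_deriv coeff_wcomp.
by rewrite weightD weight_mnm1 (inj_eq (addIr _)); case: ifP; rewrite ?mul0rn.
Qed.

Hypotheses (w1_gt0 : (0 < w1)%N) (w2_gt0 : (0 < w2)%N).

(* A rational function of degree 0 that becomes polynomial after multiplication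
   by a power of x and also by a power of y is a constant. *)
Lemma homogeneous_quotient_constant (F q s t : poly2) (N M : nat) (e : int) :
  F != 0 -> whomog e F -> whomog e q ->
  PX ^+ N * q = s * F -> PY ^+ M * q = t * F -> exists c, q = c *: F.
Proof.
move=> F0 hF hq Es Et.
pose mX := mpoly.mnm_muln (mpoly.mnm1 (ord0 : 'I_2)) N.
pose mY := mpoly.mnm_muln (mpoly.mnm1 (ord_max : 'I_2)) M.
have EX : PX ^+ N = Xm mX by rewrite /monomial mpoly.mpolyXn.
have EY : PY ^+ M = Xm mY by rewrite /monomial mpoly.mpolyXn.
have wX : weight mX = (w1 * N)%:Z.
  by rewrite /weight !mpoly.mulmnE !mpoly.mnm1E /= mul1n mul0n muln0 addn0.
(* Since [F] and x^N q are homogeneous, only the component of [s] with the weight of x^N takes part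
   in the identity. *)
pose s' := wcomp (weight mX) s.
have Es' : Xm mX * q = s' * F.
  have hXq := whomogM (@whomog_monomial mX) hq.
  have := congr1 (wcomp (weight mX + e)) Es.
  by rewrite EX (wcompM _ _ hF) addrK wcomp_id.
have st : s' * Xm mY = t * Xm mX.
  by apply: (mulIf F0); rewrite mulrAC -Es' [RHS]mulrAC -Et -EY; ring.
(* From y^M s' = t x^N, every monomial of [s'] is divisible by x^N. It also has the weight of x^N,
   so positivity of the weights makes it equal to x^N. *)
have hs m : coeff m s' != 0 -> m = mX.
  move=> nz; have wm := @whomog_wcomp (weight mX) s m nz.
  have : coeff (mpoly.mnm_add mY m) (s' * Xm mY) != 0 by rewrite mpoly.mcoeffMX.
  rewrite st -mpoly.mcoeff_msupp (perm_mem (mpoly.msuppMX _ _)) => /mapP[m' _ E].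
  have := congr1 (fun m : mpoly.multinom 2 => m ord0) E.
  rewrite !mpoly.mnmDE !mpoly.mulmnE !mpoly.mnm1E /= mul0n mul1n add0n => E0.
  move: wm; rewrite wX /weight E0 => wm.
  have {}wm : (w1 * m' ord0 + w2 * m ord_max = 0)%N by lia.
  move: wm => /eqP; rewrite addn_eq0 !muln_eq0 (gtn_eqF w1_gt0) (gtn_eqF w2_gt0) /=.
  move=> /andP[/eqP z0 /eqP z1]; apply: multinom2P.
    by rewrite E0 z0 addn0 mpoly.mulmnE mpoly.mnm1E mul1n.
  by rewrite z1 mpoly.mulmnE mpoly.mnm1E mul0n.
exists (coeff mX s').
have E : s' = coeff mX s' *: Xm mX.
  apply/mpoly.mpolyP => m; rewrite mpoly.mcoeffZ mpoly.mcoeffX.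
  have [<-|ne] := eqVneq mX m; first by rewrite mulr1.
  by rewrite mulr0; apply/eqP; apply: contraNT ne => /hs ->.
have X0 : Xm mX != 0.
  apply/eqP => /(congr1 (coeff mX)); rewrite mpoly.mcoeffX eqxx mpoly.mcoeff0.
  exact/eqP/oner_neq0.
by apply: (mulfI X0); rewrite Es' [in LHS]E -scalerAl -scalerAr.
Qed.

(** The Koszul relation (G, -F) generates the syzygies of a pair without common factor; the degrees
    of [p] and [q] are those of [G] and [F], so the multiplier has degree 0 and is a constant. *)
Lemma homogeneous_syzygy (F G a b a' b' p q : poly2) (N M : nat) (u v : int) :
  whomog u F -> whomog v G -> whomog v p -> whomog u q ->
  PX ^+ N = a * F + b * G -> PY ^+ M = a' * F + b' * G ->
  p * F + q * G = 0 -> exists c, p = c *: G /\ q = - c *: F.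
Proof.
move=> hF hG hp hq EX EY E.
have X0 : PX ^+ N != 0.
  rewrite expf_neq0 //; apply/eqP => /(congr1 (coeff (mpoly.mnm1 (ord0 : 'I_2)))).
  rewrite /monomial mpoly.mcoeffX eqxx mpoly.mcoeff0; exact/eqP/oner_neq0.
have Eq : q * G = - (p * F) by apply/eqP; rewrite -addr_eq0 addrC E.
(* If [F] vanishes, the quotient p / G is shown constant instead of q / F. *)
have [F0|F0] := eqVneq F 0.
  have G0 : G != 0 by apply: contraNneq X0 => G0; rewrite EX F0 G0 !mulr0 addr0.
  have q0 : q = 0 by apply: (mulIf G0); rewrite Eq F0 mulr0 oppr0 mul0r.
  have [c Ec] : exists c, p = c *: G.
    apply: (@homogeneous_quotient_constant G p (b * p) (b' * p) N M v) => //.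
      by rewrite EX F0; ring.
    by rewrite EY F0; ring.
  by exists c; rewrite q0 F0 scaler0.
(* Here x^N q = a F q + b G q, and G q = - p F turns the right side into (a q - b p) F; likewise for
   y^M. *)
have [c Ec] : exists c, q = c *: F.
  apply: (@homogeneous_quotient_constant F q (a * q - b * p) (a' * q - b' * p) N M u) => //.
    by rewrite EX mulrDl -[b * G * q]mulrA [G * q]mulrC Eq; ring.
  by rewrite EY mulrDl -[b' * G * q]mulrA [G * q]mulrC Eq; ring.
exists (- c); split; last by rewrite opprK.
apply: (mulIf F0); rewrite -[LHS]opprK -Eq Ec -!scalerAl scaleNr.
by rewrite [G * F]mulrC.
Qed.

Lemma euler_whomog n p : whomog n p ->
  w1%:R *: (PX * Dx p) + w2%:R *: (PY * Dy p) = n%:~R *: p.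
Proof. by move/quasi_homogeneousP. Qed.

Lemma mderiv_monomial1 (i j : 'I_2) :
  mpoly.mderiv i (monomial K (mpoly.mnm1 j)) = (i == j)%:R.
Proof.
apply/mpoly.mpolyP => m; rewrite mpoly.mcoeff_deriv /monomial mpoly.mcoeffX.
rewrite -mpoly.mpolyC_nat mpoly.mcoeffC.
have [->|ne] := eqVneq i j.
  have -> : (mpoly.mnm1 j == mpoly.mnm_add m (mpoly.mnm1 j)) = (m == @mpoly.mnm0 2).
    by rewrite -[X in X == _]mpoly.add0m (inj_eq (@mpoly.addIm _ _)) eq_sym.
  rewrite mul1r; case: eqP => [->|_]; last by rewrite mul0rn.
  by rewrite mpoly.mnm0E.
rewrite mul0r; case: eqP; last by rewrite mul0rn.
move/(congr1 (fun m : mpoly.multinom 2 => m i)).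
by rewrite mpoly.mnmDE !mpoly.mnm1E eqxx eq_sym (negbTE ne) addn1.
Qed.

(* The field X - (h / d) W, with h = g + div X, annihilates f and is therefore a
   constant multiple of the divergence free Hamiltonian field of f. *)
Lemma homogeneous_B2_trivial f g A B (a b a' b' : poly2) (N M : nat) d :
  d != 0 -> whomog d f ->
  PX ^+ N = a * Dx f + b * Dy f -> PY ^+ M = a' * Dx f + b' * Dy f ->
  whomog (d - w1%:Z - w2%:Z) g -> whomog (d - w2%:Z) A -> whomog (d - w1%:Z) B ->
  g * f = A * Dx f + B * Dy f - (Dx A + Dy B) * f -> g = 0.
Proof.
move=> d0 hf EX EY hg hA hB E.
(* This [h] already contains the factor 1 / d, so the corrected field is X - h W. *)
pose h := d%:~R^-1 *: (g + (Dx A + Dy B)).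
have dK : (d%:~R : K) != 0 by rewrite intr_eq0.
have hh : whomog (d - w1%:Z - w2%:Z) h.
  apply/whomogZ/whomogD => //; apply: whomogD; apply: whomog_deriv.
    by rewrite /= (_ : _ + _ = d - w2%:Z) //; lia.
  by rewrite /= (_ : _ + _ = d - w1%:Z) //; lia.
have hx : whomog w1%:Z PX by have := @whomog_monomial (mpoly.mnm1 ord0); rewrite weight_mnm1.
have hy : whomog w2%:Z PY by have := @whomog_monomial (mpoly.mnm1 ord_max); rewrite weight_mnm1.
have hDx : whomog (d - w1%:Z) (Dx f) by apply: whomog_deriv; rewrite /= subrK.
have hDy : whomog (d - w2%:Z) (Dy f) by apply: whomog_deriv; rewrite /= subrK.
pose p := A - w1%:R *: (PX * h); pose q := B - w2%:R *: (PY * h).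
have hp : whomog (d - w2%:Z) p.
  apply: whomogB => //; apply: whomogZ; have := whomogM hx hh.
  by rewrite (_ : _ + _ = d - w2%:Z) //; lia.
have hq : whomog (d - w1%:Z) q.
  apply: whomogB => //; apply: whomogZ; have := whomogM hy hh.
  by rewrite (_ : _ + _ = d - w1%:Z) //; lia.
(* (X - h W).f = X.f - d h f = X.f - (g + div X) f, which is zero by [E]. *)
have syz : p * Dx f + q * Dy f = 0.
  have Ef := euler_whomog hf.
  have -> : p * Dx f + q * Dy f =
      A * Dx f + B * Dy f - h * (w1%:R *: (PX * Dx f) + w2%:R *: (PY * Dy f)).
    by rewrite /p /q -!mpoly.mul_mpolyC; ring.
  rewrite Ef /h -scalerAl -scalerAr scalerA mulVf // scale1r mulrDl E.
  by ring.
have [c [Ep Eq]] := homogeneous_syzygy hDx hDy hp hq EX EY syz.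
(* The mixed partials of [f] commute; this is read off on coefficients. *)
have div0 : Dx p + Dy q = 0.
  rewrite Ep Eq !mpoly.mderivZ; apply/mpoly.mpolyP => m.
  rewrite mpoly.mcoeffD !mpoly.mcoeffZ !mpoly.mcoeff_deriv mpoly.mcoeff0.
  rewrite -!(mulr_natr (coeff _ _)) !mpoly.mnmDE !mpoly.mnm1E /= !addn0.
  rewrite -[mpoly.mnm_add (mpoly.mnm_add m (mpoly.mnm1 (ord0 : 'I_2))) _]mpoly.addmA.
  rewrite [mpoly.mnm_add (mpoly.mnm1 (ord0 : 'I_2)) _]mpoly.addmC mpoly.addmA.
  by ring.
have Eh := euler_whomog hh.
move: div0; rewrite /p /q !mpoly.mderivB !mpoly.mderivZ !mpoly.mderivM !mderiv_monomial1 /= !mul1r.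
move=> div0.
(* div (h W) = W.h + (w1 + w2) h = d h, as [h] has degree d - w1 - w2. Hence div X = d h, and g = d
   h - div X vanishes. *)
have {div0} Ed : Dx A + Dy B =
  (w1%:R *: (PX * Dx h) + w2%:R *: (PY * Dy h)) + (w1%:R + w2%:R) *: h.
  apply/eqP; rewrite -subr_eq0 -[X in _ == X]div0; apply/eqP.
  by rewrite -!mpoly.mul_mpolyC; ring.
rewrite Eh -scalerDl in Ed.
have -> : g = d%:~R *: h - (Dx A + Dy B) by rewrite /h scalerA mulfV // scale1r addrK.
rewrite Ed -scalerBl.
have -> : d%:~R - ((d - w1%:Z - w2%:Z)%:~R + (w1%:R + w2%:R)) = 0 :> K.
  by rewrite !rmorphB /= -!pmulrn; ring.
by rewrite scale0r.
Qed.

End WeightedPolynomials.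

(** * Germs and their derivatives *)

Section GermDerivatives.
Variable K : numFieldType.
Implicit Types (f g : K * K -> K) (u v : germ K).

Lemma germ_ofD f g : germ_of (f + g) = germ_of f + germ_of g.
Proof. exact: (raddfD (\pi_{ideal_quot (@null_germ K)})). Qed.

Lemma germ_ofM f g : germ_of (f * g) = germ_of f * germ_of g.
Proof. exact: (rmorphM (\pi_{ideal_quot (@null_germ K)})). Qed.

Lemma germ_of1 : germ_of (1 : K * K -> K) = 1.
Proof. exact: (rmorph1 (\pi_{ideal_quot (@null_germ K)})). Qed.

Lemma germ_ofK u : germ_of (repr u) = u.
Proof. exact: reprK. Qed.

Lemma scale_germE (a : K) u : a *: u = germ_of (cst a) * u.
Proof. by []. Qed.

Lemma germ_ofZ (a : K) f : germ_of (fun p => a * f p) = a *: germ_of f.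
Proof. by rewrite scale_germE -germ_ofM. Qed.

Lemma scale_germAl (a : K) u v : a *: (u * v) = (a *: u) * v.
Proof. by rewrite !scale_germE mulrA. Qed.

Lemma scale_germAr (a : K) u v : a *: (u * v) = u * (a *: v).
Proof. by rewrite !scale_germE mulrCA. Qed.

Lemma germ_of_cstB (a b : K) :
  germ_of (cst (a - b)) = germ_of (cst a) - germ_of (cst b).
Proof.
apply/eqP; rewrite eq_sym subr_eq -germ_ofD; apply/eqP; congr germ_of.
by apply/funext => p; rewrite -[RHS]/(a - b + b) subrK.
Qed.

Definition gx : germ K := germ_of (fun p => p.1).
Definition gy : germ K := germ_of (fun p => p.2).

Definition pderivable f (p : K * K) : Prop :=
  derivable (fun t : K => f (t, p.2)) p.1 1 /\
  derivable (fun t : K => f (p.1, t)) p.2 1.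

(** Germs come from arbitrary functions, on which [ddx] and [ddy] need not be additive or satisfy
    the Leibniz rule. Existence of both partials at every point near the origin restores these
    rules. *)
Definition gderivable u : Prop :=
  \forall p \near (0 : K * K), pderivable (repr u) p.

Lemma near0W (Q : K * K -> Prop) :
  (forall p, Q p) -> \forall p \near (0 : K * K), Q p.
Proof. by move=> H; near=> p. Unshelve. all: by end_near. Qed.

(** A partial derivative at p sees only the line through p, so a property valid near 0 must be known
    near p on that line; passing to the interior of the neighbourhood provides this. *)
Lemma near_slices (Q : K * K -> Prop) : (\forall p \near (0 : K * K), Q p) ->
  \forall p \near (0 : K * K),
    (\forall t \near p.1, Q (t, p.2)) /\ (\forall t \near p.2, Q (p.1, t)).
Proof.
move/nbhs_interior; apply: filterS => -[x y] [[/= A B] [nA nB] AB]; split.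
  by apply: filterS nA => t At; apply: (AB (t, y)); split => //; exact: nbhs_singleton.
by apply: filterS nB => t Bt; apply: (AB (x, t)); split => //; exact: nbhs_singleton.
Qed.

Lemma near_pderivable f g : (\forall p \near (0 : K * K), f p = g p) ->
  (\forall p \near (0 : K * K), pderivable f p) ->
  \forall p \near (0 : K * K), pderivable g p.
Proof.
move=> /near_slices; apply: filterS2 => p [Ex Ey] [Hx Hy].
by split; [exact: (near_eq_derivable Ex Hx) | exact: (near_eq_derivable Ey Hy)].
Qed.

Lemma gderivableP f :
  gderivable (germ_of f) <-> \forall p \near (0 : K * K), pderivable f p.
Proof.
split; apply: near_pderivable; first exact: repr_germ_of.
by apply: filterS (repr_germ_of f) => p ->.
Qed.

Lemma ddxM u v : gderivable u -> gderivable v ->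
  ddx (u * v) = ddx u * v + u * ddx v.
Proof.
rewrite -[u]germ_ofK -[v]germ_ofK; set f := repr u; set g := repr v.
move=> /gderivableP Hf /gderivableP Hg.
rewrite -germ_ofM !ddx_germ_of -!germ_ofM -germ_ofD; apply/germ_ofP.
apply: filterS2 Hf Hg => -[x y] [Hf _] [Hg _].
rewrite -[RHS]/(derive1 (fun t => f (t, y)) x * g (x, y) +
  f (x, y) * derive1 (fun t => g (t, y)) x).
rewrite /dx !derive1E; apply: (etrans (deriveM Hf Hg)).
by rewrite addrC; congr (_ + _); exact: mulrC.
Qed.

Lemma ddyM u v : gderivable u -> gderivable v ->
  ddy (u * v) = ddy u * v + u * ddy v.
Proof.
rewrite -[u]germ_ofK -[v]germ_ofK; set f := repr u; set g := repr v.
move=> /gderivableP Hf /gderivableP Hg.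
rewrite -germ_ofM !ddy_germ_of -!germ_ofM -germ_ofD; apply/germ_ofP.
apply: filterS2 Hf Hg => -[x y] [_ Hf] [_ Hg].
rewrite -[RHS]/(derive1 (fun t => f (x, t)) y * g (x, y) +
  f (x, y) * derive1 (fun t => g (x, t)) y).
rewrite /dy !derive1E; apply: (etrans (deriveM Hf Hg)).
by rewrite addrC; congr (_ + _); exact: mulrC.
Qed.

Lemma ddxD u v : gderivable u -> gderivable v -> ddx (u + v) = ddx u + ddx v.
Proof.
rewrite -[u]germ_ofK -[v]germ_ofK; set f := repr u; set g := repr v.
move=> /gderivableP Hf /gderivableP Hg.
rewrite -germ_ofD !ddx_germ_of -germ_ofD; apply/germ_ofP.
apply: filterS2 Hf Hg => -[x y] [Hf _] [Hg _].
by rewrite -[RHS]/(dx f (x, y) + dx g (x, y)) /dx !derive1E; exact: (deriveD Hf Hg).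
Qed.

Lemma ddyD u v : gderivable u -> gderivable v -> ddy (u + v) = ddy u + ddy v.
Proof.
rewrite -[u]germ_ofK -[v]germ_ofK; set f := repr u; set g := repr v.
move=> /gderivableP Hf /gderivableP Hg.
rewrite -germ_ofD !ddy_germ_of -germ_ofD; apply/germ_ofP.
apply: filterS2 Hf Hg => -[x y] [_ Hf] [_ Hg].
by rewrite -[RHS]/(dy f (x, y) + dy g (x, y)) /dy !derive1E; exact: (deriveD Hf Hg).
Qed.

Lemma gderivableM u v : gderivable u -> gderivable v -> gderivable (u * v).
Proof.
rewrite -[u]germ_ofK -[v]germ_ofK; set f := repr u; set g := repr v.
move=> /gderivableP Hf /gderivableP Hg; rewrite -germ_ofM; apply/gderivableP.
apply: filterS2 Hf Hg => p [Hfx Hfy] [Hgx Hgy].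
by split; [exact: (derivableM Hfx Hgx) | exact: (derivableM Hfy Hgy)].
Qed.

Lemma gderivable_cst (a : K) : gderivable (germ_of (cst a)).
Proof. by apply/gderivableP; apply: near0W => p; split; exact: derivable_cst. Qed.

Lemma ddx_cst (a : K) : ddx (germ_of (cst a)) = 0.
Proof.
rewrite ddx_germ_of -[RHS](raddf0 (\pi_{ideal_quot (@null_germ K)})).
by apply/germ_ofP; apply: near0W => p; rewrite /dx derive1E derive_cst.
Qed.

Lemma ddy_cst (a : K) : ddy (germ_of (cst a)) = 0.
Proof.
rewrite ddy_germ_of -[RHS](raddf0 (\pi_{ideal_quot (@null_germ K)})).
by apply/germ_ofP; apply: near0W => p; rewrite /dy derive1E derive_cst.
Qed.

Lemma gderivableZ (a : K) u : gderivable u -> gderivable (a *: u).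
Proof. by move=> Hu; exact: (gderivableM (gderivable_cst a) Hu). Qed.

Lemma ddxZ (a : K) u : gderivable u -> ddx (a *: u) = a *: ddx u.
Proof.
by move=> Hu; rewrite !scale_germE (ddxM (gderivable_cst a) Hu) ddx_cst mul0r add0r.
Qed.

Lemma ddyZ (a : K) u : gderivable u -> ddy (a *: u) = a *: ddy u.
Proof.
by move=> Hu; rewrite !scale_germE (ddyM (gderivable_cst a) Hu) ddy_cst mul0r add0r.
Qed.

Lemma ddxB u v : gderivable u -> gderivable v -> ddx (u - v) = ddx u - ddx v.
Proof.
move=> Hu Hv; have E : - v = (-1) *: v by rewrite scaleN1r.
by rewrite E (ddxD Hu (gderivableZ _ Hv)) (ddxZ _ Hv) scaleN1r.
Qed.

Lemma ddyB u v : gderivable u -> gderivable v -> ddy (u - v) = ddy u - ddy v.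
Proof.
move=> Hu Hv; have E : - v = (-1) *: v by rewrite scaleN1r.
by rewrite E (ddyD Hu (gderivableZ _ Hv)) (ddyZ _ Hv) scaleN1r.
Qed.

Lemma gderivable_gx : gderivable gx.
Proof.
by apply/gderivableP; apply: near0W => p; split; [exact: derivable_id | exact: derivable_cst].
Qed.

Lemma gderivable_gy : gderivable gy.
Proof.
by apply/gderivableP; apply: near0W => p; split; [exact: derivable_cst | exact: derivable_id].
Qed.

Lemma ddx_gx : ddx gx = 1.
Proof.
rewrite ddx_germ_of -germ_of1; apply/germ_ofP; apply: near0W => p.
by rewrite /dx derive1E derive_id.
Qed.

Lemma ddy_gy : ddy gy = 1.
Proof.
rewrite ddy_germ_of -germ_of1; apply/germ_ofP; apply: near0W => p.
by rewrite /dy derive1E derive_id.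
Qed.

Lemma ddx_gy : ddx gy = 0.
Proof.
rewrite ddx_germ_of -[RHS](raddf0 (\pi_{ideal_quot (@null_germ K)})).
by apply/germ_ofP; apply: near0W => p; rewrite /dx derive1E derive_cst.
Qed.

Lemma ddy_gx : ddy gx = 0.
Proof.
rewrite ddy_germ_of -[RHS](raddf0 (\pi_{ideal_quot (@null_germ K)})).
by apply/germ_ofP; apply: near0W => p; rewrite /dy derive1E derive_cst.
Qed.

End GermDerivatives.

Arguments gx {K}.
Arguments gy {K}.

(** * Reduction to Hadamard's lemma and the invertibility of W + n *)

Section RegularClass.
Variable K : numFieldType.
Variables w1 w2 : nat.
Hypotheses (w1_gt0 : (0 < w1)%N) (w2_gt0 : (0 < w2)%N).
Variable S : set (germ K).

(* What the proof uses of a category of germs: W + n.+1 is invertible on it and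
   Hadamard's lemma holds. *)
Record regular_class : Prop := RegularClass {
  reg_lin : forall (a : K) u v, S u -> S v -> S (a *: u + v);
  reg1 : S 1;
  reg_gx : forall u, S u -> S (gx * u);
  reg_gy : forall u, S u -> S (gy * u);
  reg_derivable : forall u, S u -> gderivable u;
  reg_ddx : forall u, S u -> S (ddx u);
  reg_ddy : forall u, S u -> S (ddy u);
  reg_hadamard : forall u, S u -> exists (c : K) a b,
    [/\ S a, S b & u = c *: (1 : germ K) + (gx * a + gy * b)];
  reg_solve : forall (n : nat) u, S u -> exists2 h, S h &
    w1%:R *: (gx * ddx h) + w2%:R *: (gy * ddy h) + n.+1%:R *: h = u }.

Hypothesis RS : regular_class.

Local Notation poly2 := (mpoly.mpoly 2 K).
Local Notation coeff := mpoly.mcoeff.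
Local Notation Dx := (mpoly.mderiv (ord0 : 'I_2)).
Local Notation Dy := (mpoly.mderiv (ord_max : 'I_2)).
Local Notation PX := (monomial K (mpoly.mnm1 (ord0 : 'I_2))).
Local Notation PY := (monomial K (mpoly.mnm1 (ord_max : 'I_2))).
Local Notation P := (@poly_germ K).
Local Notation weight := (weight w1 w2).
Local Notation wcomp := (wcomp w1 w2).
Local Notation whomog := (@whomog K w1 w2).
Implicit Types (p q f g : poly2) (m : mpoly.multinom 2) (u v : germ K).

Lemma poly_germD p q : P (p + q) = P p + P q.
Proof. by rewrite -germ_ofD; congr germ_of; apply/funext => t; rewrite mpoly.mevalD. Qed.

Lemma poly_germM p q : P (p * q) = P p * P q.
Proof. by rewrite -germ_ofM; congr germ_of; apply/funext => t; rewrite mpoly.mevalM. Qed.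

Lemma poly_germZ a p : P (a *: p) = a *: P p.
Proof. by rewrite -germ_ofZ; congr germ_of; apply/funext => t; rewrite mpoly.mevalZ. Qed.

Lemma poly_germ1 : P 1 = 1.
Proof. by rewrite -germ_of1; congr germ_of; apply/funext => t; rewrite mpoly.meval1. Qed.

Lemma poly_germ0 : P 0 = 0.
Proof. by rewrite -(scale0r (0 : poly2)) poly_germZ scale0r. Qed.

Lemma poly_germN p : P (- p) = - P p.
Proof. by apply/eqP; rewrite -addr_eq0 -poly_germD addNr poly_germ0. Qed.

Lemma poly_germB p q : P (p - q) = P p - P q.
Proof. by rewrite poly_germD poly_germN. Qed.

Lemma poly_germX : P PX = gx.
Proof. by congr germ_of; apply/funext => t; rewrite mpoly.mevalXU eqxx. Qed.

Lemma poly_germY : P PY = gy.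
Proof. by congr germ_of; apply/funext => t; rewrite mpoly.mevalXU. Qed.

Lemma poly_germ_sum (I : Type) (r : seq I) (F : I -> poly2) :
  P (\sum_(i <- r) F i) = \sum_(i <- r) P (F i).
Proof. by apply: (big_morph P) => [p q|]; [exact: poly_germD | exact: poly_germ0]. Qed.

Lemma monomialE m : monomial K m = PX ^+ m ord0 * PY ^+ m ord_max.
Proof.
rewrite /monomial !mpoly.mpolyXn -mpoly.mpolyXD; congr mpoly.mpolyX.
by apply: multinom2P; rewrite mpoly.mnmDE !mpoly.mulmnE !mpoly.mnm1E /= ?mul1n ?mul0n ?addn0.
Qed.

(** The four cases mirror the closure properties recorded in [regular_class], so polynomial facts
    transfer to germs without touching coefficients. *)
Lemma poly2_ind (Q : poly2 -> Prop) : Q 1 ->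
  (forall p, Q p -> Q (PX * p)) -> (forall p, Q p -> Q (PY * p)) ->
  (forall a p q, Q p -> Q q -> Q (a *: p + q)) -> forall p, Q p.
Proof.
move=> Q1 QX QY Qlin.
have Q0 : Q 0 by have := Qlin (-1) _ _ Q1 Q1; rewrite scaleN1r addNr.
elim/mpoly.mpolyind => // c m p _ _ Qp; apply: Qlin => //.
rewrite -/(monomial K m) monomialE.
elim: (m ord0) => [|i IH]; last by rewrite exprS -mulrA; apply: QX.
by rewrite mul1r; elim: (m ord_max) => // i IH; rewrite exprS; apply: QY.
Qed.

Lemma regD u v : S u -> S v -> S (u + v).
Proof. by move=> Su Sv; rewrite -[u]scale1r; apply: (reg_lin RS). Qed.

Lemma reg0 : S 0.
Proof. by rewrite -(addNr (1 : germ K)) -scaleN1r; apply: (reg_lin RS); exact: (reg1 RS). Qed.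

Lemma regZ a u : S u -> S (a *: u).
Proof. by move=> Su; rewrite -[_ *: _]addr0; apply: (reg_lin RS) => //; exact: reg0. Qed.

Lemma regN u : S u -> S (- u).
Proof. by rewrite -scaleN1r; exact: regZ. Qed.

Lemma regB u v : S u -> S v -> S (u - v).
Proof. by move=> Su Sv; apply: regD => //; exact: regN. Qed.

(** Every product formed in the argument has a polynomial factor (f, its partials, a coordinate), so
    stability under x and y replaces stability under products of germs. *)
Lemma reg_polyM p u : S u -> S (P p * u).
Proof.
move=> Su; elim/poly2_ind: p => [|p Sp|p Sp|a p q Sp Sq].
- by rewrite poly_germ1 mul1r.
- by rewrite poly_germM poly_germX -mulrA; exact: (reg_gx RS).
- by rewrite poly_germM poly_germY -mulrA; exact: (reg_gy RS).
- by rewrite poly_germD poly_germZ mulrDl -scale_germAl; exact: (reg_lin RS).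
Qed.

Lemma reg_poly p : S (P p).
Proof. by rewrite -[P p]mulr1; apply: reg_polyM; exact: (reg1 RS). Qed.

Lemma gderivable_poly p : gderivable (P p).
Proof. exact: (reg_derivable RS (reg_poly p)). Qed.

Lemma ddx_poly p : ddx (P p) = P (Dx p).
Proof.
elim/poly2_ind: p => [|p Ep|p Ep|a p q Ep Eq].
- rewrite poly_germ1 -germ_of1 ddx_cst -[1]/(mpoly.mpolyC 2 1).
  by rewrite mpoly.mderivC poly_germ0.
- rewrite mpoly.mderivM mderiv_monomial1 poly_germD !poly_germM poly_germX.
  rewrite ddxM; [|exact: gderivable_gx|exact: gderivable_poly].
  by rewrite ddx_gx poly_germ1 Ep.
- rewrite mpoly.mderivM mderiv_monomial1 poly_germD !poly_germM poly_germY.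
  rewrite ddxM; [|exact: gderivable_gy|exact: gderivable_poly].
  by rewrite ddx_gy poly_germ0 Ep.
- rewrite poly_germD poly_germZ ddxD; last 2 first.
  + exact/gderivableZ/gderivable_poly.
  + exact: gderivable_poly.
  rewrite ddxZ; last exact: gderivable_poly.
  by rewrite Ep Eq mpoly.mderivD mpoly.mderivZ poly_germD poly_germZ.
Qed.

Lemma ddy_poly p : ddy (P p) = P (Dy p).
Proof.
elim/poly2_ind: p => [|p Ep|p Ep|a p q Ep Eq].
- rewrite poly_germ1 -germ_of1 ddy_cst -[1]/(mpoly.mpolyC 2 1).
  by rewrite mpoly.mderivC poly_germ0.
- rewrite mpoly.mderivM mderiv_monomial1 poly_germD !poly_germM poly_germX.
  rewrite ddyM; [|exact: gderivable_gx|exact: gderivable_poly].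
  by rewrite ddy_gx poly_germ0 Ep.
- rewrite mpoly.mderivM mderiv_monomial1 poly_germD !poly_germM poly_germY.
  rewrite ddyM; [|exact: gderivable_gy|exact: gderivable_poly].
  by rewrite ddy_gy poly_germ1 Ep.
- rewrite poly_germD poly_germZ ddyD; last 2 first.
  + exact/gderivableZ/gderivable_poly.
  + exact: gderivable_poly.
  rewrite ddyZ; last exact: gderivable_poly.
  by rewrite Ep Eq mpoly.mderivD mpoly.mderivZ poly_germD poly_germZ.
Qed.

(* The germs of S lying in the n-th power of the maximal ideal. *)
Fixpoint vanishing n : set (germ K) :=
  if n is n'.+1 then [set gx * a + gy * b | a in vanishing n' & b in vanishing n']
  else S.

Lemma vanishing_lin n a u v :
  vanishing n u -> vanishing n v -> vanishing n (a *: u + v).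
Proof.
elim: n u v => [|n IH] u v; first exact: (reg_lin RS).
move=> [u1 Hu1 [u2 Hu2 <-]] [v1 Hv1 [v2 Hv2 <-]].
exists (a *: u1 + v1); first exact: IH.
exists (a *: u2 + v2); first exact: IH.
by rewrite scalerDr !scale_germAr !mulrDr addrACA.
Qed.

Lemma vanishingD n u v : vanishing n u -> vanishing n v -> vanishing n (u + v).
Proof. by move=> hu hv; rewrite -[u]scale1r; apply: vanishing_lin. Qed.

Lemma vanishingB n u v : vanishing n u -> vanishing n v -> vanishing n (u - v).
Proof. by move=> hu hv; rewrite addrC -scaleN1r; apply: vanishing_lin. Qed.

Lemma vanishing_sub n u : vanishing n u -> S u.
Proof.
elim: n u => [//|n IH] u [a /IH Sa [b /IH Sb <-]].
by apply: regD; [exact: (reg_gx RS) | exact: (reg_gy RS)].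
Qed.

Lemma vanishing_gx n u : vanishing n u -> vanishing n (gx * u).
Proof.
elim: n u => [|n IH] u; first exact: (reg_gx RS).
move=> [a Ha [b Hb <-]]; exists (gx * a); first exact: IH.
by exists (gx * b); [exact: IH | rewrite mulrDr; congr (_ + _); rewrite mulrCA].
Qed.

Lemma vanishing_gy n u : vanishing n u -> vanishing n (gy * u).
Proof.
elim: n u => [|n IH] u; first exact: (reg_gy RS).
move=> [a Ha [b Hb <-]]; exists (gy * a); first exact: IH.
by exists (gy * b); [exact: IH | rewrite mulrDr; congr (_ + _); rewrite mulrCA].
Qed.

Lemma vanishing_polyM n p u : vanishing n u -> vanishing n (P p * u).
Proof.
move=> Su; elim/poly2_ind: p => [|p Sp|p Sp|a p q Sp Sq].
- by rewrite poly_germ1 mul1r.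
- by rewrite poly_germM poly_germX -mulrA; exact: vanishing_gx.
- by rewrite poly_germM poly_germY -mulrA; exact: vanishing_gy.
- by rewrite poly_germD poly_germZ mulrDl -scale_germAl; exact: vanishing_lin.
Qed.

Lemma vanishingS n u : vanishing n.+1 u -> vanishing n u.
Proof.
elim: n u => [|n IH] u; first exact: (@vanishing_sub 1).
by move=> [a /IH Ha [b /IH Hb <-]]; exists a => //; exists b.
Qed.

(** The Leibniz rule on x a + y b leaves the term [a], which has the required order, and x a_x + y
    b_x, where the factor x or y makes up for the order lost by differentiating. *)
Lemma vanishing_ddx n u : vanishing n.+1 u -> vanishing n (ddx u).
Proof.
elim: n u => [|n IH] u; first by move/vanishing_sub; exact: (reg_ddx RS).
move=> [a Ha [b Hb <-]].
have Da := reg_derivable RS (@vanishing_sub n.+1 _ Ha).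
have Db := reg_derivable RS (@vanishing_sub n.+1 _ Hb).
have Dgx := gderivable_gx K; have Dgy := gderivable_gy K.
rewrite ddxD; [|exact: gderivableM|exact: gderivableM].
rewrite !ddxM // ddx_gx ddx_gy mul1r mul0r add0r -addrA.
apply: vanishingD => //.
by exists (ddx a); [exact: IH | exists (ddx b); [exact: IH|]].
Qed.

Lemma vanishing_ddy n u : vanishing n.+1 u -> vanishing n (ddy u).
Proof.
elim: n u => [|n IH] u; first by move/vanishing_sub; exact: (reg_ddy RS).
move=> [a Ha [b Hb <-]].
have Da := reg_derivable RS (@vanishing_sub n.+1 _ Ha).
have Db := reg_derivable RS (@vanishing_sub n.+1 _ Hb).
have Dgx := gderivable_gx K; have Dgy := gderivable_gy K.
rewrite ddyD; [|exact: gderivableM|exact: gderivableM].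
rewrite !ddyM // ddy_gx ddy_gy mul1r mul0r add0r addrCA.
apply: vanishingD => //.
by exists (ddy a); [exact: IH | exists (ddy b); [exact: IH|]].
Qed.

(** A Taylor polynomial, obtained by applying Hadamard's lemma [n] times to the successive
    quotients. The remainder keeps its coefficients in [S], so it can be differentiated again. *)
Lemma vanishing_expansion n u : S u -> exists p, vanishing n (u - P p).
Proof.
elim: n u => [|n IH] u Su; first by exists 0; rewrite poly_germ0 subr0.
have [c [a [b [/IH[pa Ha] /IH[pb Hb] ->]]]] := reg_hadamard RS Su.
exists (c *: 1 + (PX * pa + PY * pb)).
exists (a - P pa) => //; exists (b - P pb) => //.
rewrite !poly_germD poly_germZ poly_germ1 !poly_germM poly_germX poly_germY.
by ring.
Qed.

(** The germ identity P p = x a + y b is evaluated at the origin itself. *)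
Lemma vanishing_eval0 n p : vanishing n.+1 (P p) -> coeff (@mpoly.mnm0 2) p = 0.
Proof.
move=> [a _ [b _ E]].
have : P p = germ_of ((fun q : K * K => q.1) * repr a + (fun q : K * K => q.2) * repr b).
  by rewrite germ_ofD !germ_ofM !germ_ofK.
move=> /germ_ofP /nbhs_singleton.
rewrite -[RHS]/(0 * _ + 0 * _) !mul0r addr0 /= => <-.
elim/mpoly.mpolyind: p {E} => [|c m p _ _ IH]; first by rewrite mpoly.mcoeff0 mpoly.meval0.
rewrite mpoly.mevalD mpoly.mevalZ mpoly.mcoeffD mpoly.mcoeffZ IH; congr (_ * _ + _).
rewrite mpoly.mcoeffX mpoly.mevalX.
under eq_bigr => i _ do rewrite if_same.
have [->|m0] := eqVneq m (@mpoly.mnm0 2).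
  by rewrite big1 // => i _; rewrite mpoly.mnm0E.
have [i mi] : exists i, m i != 0%N.
  apply/existsP; apply: contraNT m0; rewrite negb_exists => /forallP h.
  by apply/eqP/mpoly.mnmP => i; rewrite mpoly.mnm0E; apply/eqP; rewrite -[_ == _]negbK.
by rewrite (bigD1 i) //= expr0n (negbTE mi) mul0r.
Qed.

(** Differentiation lowers the order of vanishing and the degree of the monomial together,
    multiplying the coefficient by a nonzero integer, until only the constant term is left. *)
Lemma vanishing_coeff n p m :
  vanishing n (P p) -> (m ord0 + m ord_max < n)%N -> coeff m p = 0.
Proof.
elim: n p m => // n IH p m H lt.
have step (i : 'I_2) : vanishing n (P (mpoly.mderiv i p)) -> (0 < m i)%N ->
    (m ord0 + m ord_max).-1 =
      (mpoly.mnm_sub m (mpoly.mnm1 i) ord0 + mpoly.mnm_sub m (mpoly.mnm1 i) ord_max)%N ->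
    coeff m p = 0.
  move=> Hi mi E; have := IH _ (mpoly.mnm_sub m (mpoly.mnm1 i)) Hi.
  rewrite mpoly.mcoeff_deriv mpoly.submK; last by rewrite mpoly.lep1mP -lt0n.
  rewrite -E => /(_ _)/eqP; rewrite mulrn_eq0 /= => h; apply/eqP/h.
  by move: mi lt; case: (ord2P i) => ->; lia.
have [m0|m0] := posnP (m ord0); last first.
  apply: (step ord0) => //; first by rewrite -ddx_poly; exact: vanishing_ddx.
  by rewrite !mpoly.mnmBE !mpoly.mnm1E /=; lia.
have [m1|m1] := posnP (m ord_max); last first.
  apply: (step ord_max) => //; first by rewrite -ddy_poly; exact: vanishing_ddy.
  by rewrite !mpoly.mnmBE !mpoly.mnm1E /=; lia.
suff -> : m = @mpoly.mnm0 2 by exact: vanishing_eval0 H.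
by apply: multinom2P; rewrite mpoly.mnm0E.
Qed.

(** As both weights are at least 1, the weight of a monomial is at least its total degree. This
    turns identities up to high order into exact identities between components. *)
Lemma vanishing_wcomp n p (k : int) : vanishing n (P p) -> k < n%:Z -> wcomp k p = 0.
Proof.
move=> H kn; apply/mpoly.mpolyP => m; rewrite coeff_wcomp mpoly.mcoeff0.
case: eqP => // wm; apply: (vanishing_coeff H).
move: kn; rewrite -wm /weight => kn.
have : (m ord0 <= w1 * m ord0)%N by rewrite leq_pmull.
have : (m ord_max <= w2 * m ord_max)%N by rewrite leq_pmull.
by lia.
Qed.

Variables (d : int) (f : poly2) (c : nat) (mu : 'I_c -> mpoly.multinom 2).
Hypothesis f_whomog : whomog d f.

Local Notation F := (P f).
Local Notation k := (d - w1%:Z - w2%:Z).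

(** These two sets repeat [jacobian_ideal] and [B2] for an abstract class [S], and become
    convertible with them once [S] is the set of regular germs. *)
Definition jacobian : set (germ K) := [set a * ddx F + b * ddy F | a in S & b in S].

Definition boundaries : set (germ K) :=
  [set action X F - divergence X * F | X in S `*` S].

Hypothesis mu_basis : quot_basis S jacobian (fun j => P (monomial K (mu j))).

Lemma Dxf_whomog : whomog (d - w1%:Z) (Dx f).
Proof. by apply: whomog_deriv; rewrite /= subrK. Qed.

Lemma Dyf_whomog : whomog (d - w2%:Z) (Dy f).
Proof. by apply: whomog_deriv; rewrite /= subrK. Qed.

(* The weighted component of degree weight m of an expansion of the monomial m
   in the monomial basis: no basis monomial contributes when m is heavy. *)
Lemma heavy_monomial_jacobian m : (forall j, weight (mu j) < weight m) ->
  exists a b : poly2, monomial K m = a * Dx f + b * Dy f.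
Proof.
move=> heavy; have [_ _ gen] := mu_basis.
have [al [A SA [B SB E]]] := gen _ (reg_poly (monomial K m)).
(* One more than the weight to be isolated, so that the Taylor remainders of [A] and [B] cannot
   contribute to it. *)
pose n := `|weight m|.+1%N.
have [p Hp] := vanishing_expansion n SA; have [q Hq] := vanishing_expansion n SB.
pose Z := monomial K m - \sum_j al j *: monomial K (mu j) - (p * Dx f + q * Dy f).
have HZ : vanishing n (P Z).
  rewrite /Z !poly_germB poly_germD !poly_germM poly_germ_sum.
  under eq_bigr do rewrite poly_germZ.
  rewrite -E ddx_poly ddy_poly opprD addrACA -!mulrBl ![(_ - _) * _]mulrC.
  by apply: vanishingD; exact: vanishing_polyM.
have := vanishing_wcomp HZ (k := weight m); rewrite /n.
have -> : weight m < `|weight m|.+1%:Z by rewrite -addn1 PoszD abszE; lia.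
move/(_ isT); rewrite /Z !wcompB wcompD (wcompM _ _ Dxf_whomog) (wcompM _ _ Dyf_whomog).
rewrite (wcomp_id (@whomog_monomial K w1 w2 m)).
rewrite (big_morph (wcomp (weight m)) (@wcompD K w1 w2 (weight m))
  (@wcomp0 K w1 w2 (weight m))) big1 => [|j _].
  by rewrite subr0 => /eqP; rewrite subr_eq0 => /eqP ->; eexists; eexists.
rewrite wcompZ (wcomp_whomog _ (@whomog_monomial K w1 w2 (mu j))).
by rewrite gt_eqF ?scaler0.
Qed.

(** There are finitely many basis monomials, and the [N]-th power of a coordinate has weight at
    least [N]; taking [N] above all their weights makes it heavy. *)
Lemma power_jacobian (i : 'I_2) : exists (N : nat) (a b : poly2),
  monomial K (mpoly.mnm1 i) ^+ N = a * Dx f + b * Dy f.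
Proof.
pose N := (\max_j `|weight (mu j)|)%N.+1.
have [j|a [b E]] := @heavy_monomial_jacobian (mpoly.mnm_muln (mpoly.mnm1 i) N).
  have le : (`|weight (mu j)|%N <= \max_j `|weight (mu j)|)%N by exact: leq_bigmax.
  have leN : (N%:Z <= weight (mpoly.mnm_muln (mpoly.mnm1 i) N)).
    rewrite /weight !mpoly.mulmnE !mpoly.mnm1E.
    case: (ord2P i) => -> /=; rewrite !mul1n !mul0n !muln0 ?addn0 ?add0n lez_nat.
      by rewrite leq_pmull.
    by rewrite leq_pmull.
  apply: lt_le_trans leN; rewrite /N.
  have : weight (mu j) <= `|weight (mu j)|%N%:Z by rewrite abszE ler_norm.
  by move: le; lia.
by exists N, a, b; rewrite -E /monomial mpoly.mpolyXn.
Qed.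

(** With positive weights, degree 0 would make [f] constant; its partials would vanish and could not
    produce a power of x. *)
Lemma degree_neq0 : d != 0.
Proof.
apply/eqP => d0; have [N [a [b]]] := power_jacobian ord0.
have D0 i : mpoly.mderiv i f = 0.
  apply/mpoly.mpolyP => m; rewrite mpoly.mcoeff_deriv mpoly.mcoeff0.
  have [->|/f_whomog] := eqVneq (coeff (mpoly.mnm_add m (mpoly.mnm1 i)) f) 0; first by rewrite mul0rn.
  rewrite weightD weight_mnm1 d0 /weight => h.
  by move: w1_gt0 w2_gt0 h; case: ifP; lia.
rewrite !D0 !mulr0 addr0 => /eqP; rewrite expf_eq0 => /andP[_ /eqP].
move/(congr1 (coeff (mpoly.mnm1 (ord0 : 'I_2)))).
by rewrite /monomial mpoly.mcoeffX eqxx mpoly.mcoeff0 => /eqP; rewrite oner_eq0.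
Qed.

Let dK : (d%:~R : K) != 0.
Proof. by rewrite intr_eq0 degree_neq0. Qed.

Lemma ddxF : ddx F = P (Dx f). Proof. exact: ddx_poly. Qed.
Lemma ddyF : ddy F = P (Dy f). Proof. exact: ddy_poly. Qed.

Lemma euler_germ : w1%:R *: (gx * ddx F) + w2%:R *: (gy * ddy F) = d%:~R *: F.
Proof.
rewrite ddxF ddyF -poly_germX -poly_germY -!poly_germM -!poly_germZ -poly_germD.
by rewrite (euler_whomog f_whomog).
Qed.

(** The passage from a field of germs to a polynomial field: the Taylor polynomials of its
    coefficients satisfy the same equation in weight k + d, the weight of g f. *)
Lemma wcomp_boundary g : whomog k g -> boundaries (P (g * f)) -> g = 0.
Proof.
move=> hg [[A B] /= [SA SB]]; rewrite /action /divergence /= => E.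
pose n := `|(k + d)%R|.+1%N.
(* One order beyond [n], because the divergence differentiates the remainders once. *)
have [p Hp] := vanishing_expansion n.+1 SA; have [q Hq] := vanishing_expansion n.+1 SB.
pose Z := g * f - (p * Dx f + q * Dy f - (Dx p + Dy q) * f).
have HZ : vanishing n (P Z).
  have Ep : ddx (A - P p) = ddx A - ddx (P p).
    exact: (ddxB (reg_derivable RS SA) (gderivable_poly p)).
  have Eq : ddy (B - P q) = ddy B - ddy (P q).
    exact: (ddyB (reg_derivable RS SB) (gderivable_poly q)).
  have -> : P Z = P (Dx f) * (A - P p) + P (Dy f) * (B - P q) -
       (F * ddx (A - P p) + F * ddy (B - P q)).
    rewrite Ep Eq !poly_germB -E poly_germD !poly_germM poly_germD.
    by rewrite -(ddx_poly p) -(ddy_poly q) ddxF ddyF; ring.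
  apply: vanishingB; apply: vanishingD; apply: vanishing_polyM.
  - exact: vanishingS.
  - exact: vanishingS.
  - exact: vanishing_ddx.
  - exact: vanishing_ddy.
have := vanishing_wcomp HZ (k := k + d); rewrite /n.
have -> : k + d < `|(k + d)%R|.+1%:Z by rewrite -addn1 PoszD abszE; lia.
(* In weight k + d only the components of [p] and [q] of weights d - w2 and d - w1 remain, that is,
   the part of the field of weight k. *)
move/(_ isT); rewrite /Z !wcompB wcompD (wcompM _ _ Dxf_whomog) (wcompM _ _ Dyf_whomog).
rewrite !(wcompM _ _ f_whomog) addrK wcompD !wcomp_deriv /= (wcomp_id hg).
have -> : k + d - (d - w1%:Z) = d - w2%:Z by lia.
have -> : k + d - (d - w2%:Z) = d - w1%:Z by lia.
have -> : k + w1%:Z = d - w2%:Z by lia.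
have -> : k + w2%:Z = d - w1%:Z by lia.
move/eqP; rewrite subr_eq0 => /eqP {}E.
have [N [a [b EX]]] := power_jacobian ord0.
have [M [a' [b' EY]]] := power_jacobian ord_max.
apply: (homogeneous_B2_trivial w1_gt0 w2_gt0 degree_neq0 f_whomog EX EY hg _ _ E);
  exact: whomog_wcomp.
Qed.

(** Euler's identity f = (w1 x f_x + w2 y f_y) / d. *)
Lemma jacobian_mulF u : S u -> jacobian (u * F).
Proof.
move=> Su.
exists ((d%:~R^-1 * w1%:R) *: (gx * u)); first exact/regZ/(reg_gx RS).
exists ((d%:~R^-1 * w2%:R) *: (gy * u)); first exact/regZ/(reg_gy RS).
have -> : u * F = u * (d%:~R^-1 *: (d%:~R *: F)) by rewrite scalerA mulVf // scale1r.
by rewrite -euler_germ !scale_germE !germ_ofM; ring.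
Qed.

Lemma jacobian_lin a u v : jacobian u -> jacobian v -> jacobian (a *: u + v).
Proof.
move=> [u1 S1 [u2 S2 <-]] [v1 T1 [v2 T2 <-]].
exists (a *: u1 + v1); first exact: (reg_lin RS).
exists (a *: u2 + v2); first exact: (reg_lin RS).
by rewrite !scale_germE; ring.
Qed.

Lemma boundaries_jacobian u : boundaries u -> jacobian u.
Proof.
move=> [[A B] /= [SA SB] <-]; rewrite /action /divergence /=.
rewrite addrC -mulNr; have -> : - (ddx A + ddy B) * F = 1 *: (- (ddx A + ddy B) * F).
  by rewrite scale1r.
apply: jacobian_lin; last by exists A => //; exists B.
apply: jacobian_mulF.
by apply/regN/regD; [exact: (reg_ddx RS) | exact: (reg_ddy RS)].
Qed.

(* Hadamard's lemma reduces the degree n to n - w1 and n - w2 until it is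
   negative, where W - n is invertible. *)
Lemma homological_equation (n : int) u : S u -> exists p h,
  [/\ whomog n p, S h &
      u = P p + (w1%:R *: (gx * ddx h) + w2%:R *: (gy * ddy h) - n%:~R *: h)].
Proof.
(* In negative degree the polynomial part is zero and W - n' is W + |n'|; the predecessor matches
   the shift in [reg_solve]. *)
have base n' v : n' < 0 -> S v -> exists p h, [/\ whomog n' p, S h &
      v = P p + (w1%:R *: (gx * ddx h) + w2%:R *: (gy * ddy h) - n'%:~R *: h)].
  move=> n0 Sv; have [h Sh Eh] := reg_solve RS `|n'|%N.-1 Sv.
  exists 0, h; split=> // [m|]; first by rewrite mpoly.mcoeff0 eqxx.
  rewrite poly_germ0 add0r -[LHS]Eh; congr (_ + _).
  have -> : `|n'|%N.-1.+1 = `|n'|%N by rewrite prednK // absz_gt0 lt_eqF.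
  by rewrite pmulrn abszE ltr0_norm // rmorphN scaleNr.
case: n => [n|n]; last exact: base.
elim/ltn_ind: n u => n IH u Su.
have {}IH n' v : n' < n%:Z -> S v -> exists p h, [/\ whomog n' p, S h &
      v = P p + (w1%:R *: (gx * ddx h) + w2%:R *: (gy * ddy h) - n'%:~R *: h)].
  by case: n' => [n'|n'] lt Sv; [exact: IH | exact: base].
have [a0 [a [b [Sa Sb ->]]]] := reg_hadamard RS Su.
have [pa [ha [pa_hom Sha ->]]] : exists p h, [/\ whomog (n%:Z - w1%:Z) p, S h &
      a = P p + (w1%:R *: (gx * ddx h) + w2%:R *: (gy * ddy h) - (n%:Z - w1%:Z)%:~R *: h)].
  by apply: IH => //; lia.
have [pb [hb [pb_hom Shb ->]]] : exists p h, [/\ whomog (n%:Z - w2%:Z) p, S h &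
      b = P p + (w1%:R *: (gx * ddx h) + w2%:R *: (gy * ddy h) - (n%:Z - w2%:Z)%:~R *: h)].
  by apply: IH => //; lia.
have hx : whomog w1%:Z PX by have := @whomog_monomial K w1 w2 (mpoly.mnm1 ord0); rewrite weight_mnm1.
have hy : whomog w2%:Z PY by have := @whomog_monomial K w1 w2 (mpoly.mnm1 ord_max); rewrite weight_mnm1.
have hxa : whomog n%:Z (PX * pa) by have := whomogM hx pa_hom; rewrite subrKC.
have hyb : whomog n%:Z (PY * pb) by have := whomogM hy pb_hom; rewrite subrKC.
have h1 : whomog 0 (1 : poly2).
  move=> m; rewrite mpoly.mcoeff1; have [->|] := eqVneq m (@mpoly.mnm0 2); last by rewrite eqxx.
  by rewrite /weight !mpoly.mnm0E !muln0.
have Dha := reg_derivable RS Sha; have Dhb := reg_derivable RS Shb.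
have Dgx := gderivable_gx K; have Dgy := gderivable_gy K.
pose h0 := gx * ha + gy * hb.
have Sh0 : S h0 by apply: regD; [exact: (reg_gx RS) | exact: (reg_gy RS)].
have Dh0 := reg_derivable RS Sh0.
set u0 := gx * _ + gy * _.
(* Since W.x = w1 x, (W - n)(x h) = x (W - (n - w1)) h, and similarly for y with w2. The solutions
   for the two Hadamard quotients thus combine into [h0]. *)
have {u0} -> : u0 = P (PX * pa + PY * pb) +
    (w1%:R *: (gx * ddx h0) + w2%:R *: (gy * ddy h0) - n%:~R *: h0).
  rewrite /u0 /h0 (ddxD (gderivableM Dgx Dha) (gderivableM Dgy Dhb)).
  rewrite (ddyD (gderivableM Dgx Dha) (gderivableM Dgy Dhb)).
  rewrite (ddxM Dgx Dha) (ddxM Dgy Dhb) (ddyM Dgx Dha) (ddyM Dgy Dhb).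
  rewrite ddx_gx ddx_gy ddy_gx ddy_gy poly_germD !poly_germM poly_germX poly_germY.
  have E (w : nat) : germ_of (cst ((n%:Z - w%:Z)%:~R : K)) =
      germ_of (cst (n%:~R)) - germ_of (cst w%:R).
    by rewrite rmorphB /= -!pmulrn germ_of_cstB.
  by rewrite !scale_germE !E; ring.
(* The value [a0] at the origin is itself homogeneous when n = 0; otherwise a0 = (W - n)(- a0 / n),
   which accounts for the correction [c1]. *)
have [n0|n0] := posnP n.
- exists (a0 *: 1 + (PX * pa + PY * pb)), h0; split=> //.
    by apply: whomogD; [apply: whomogZ; rewrite n0 | exact: whomogD].
  by rewrite (poly_germD (a0 *: 1)) poly_germZ poly_germ1 addrA.
- pose c1 : germ K := (a0 / n%:R) *: (1 : germ K).
  have Sc1 : S c1 by exact/regZ/(reg1 RS).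
  have Dc1 := reg_derivable RS Sc1.
  have c1x : ddx c1 = 0 by rewrite /c1 scale_germE mulr1 ddx_cst.
  have c1y : ddy c1 = 0 by rewrite /c1 scale_germE mulr1 ddy_cst.
  have nc1 : n%:~R *: c1 = a0 *: (1 : germ K).
    by rewrite /c1 scalerA -pmulrn mulrCA mulfV ?mulr1 // pnatr_eq0 -lt0n.
  exists (PX * pa + PY * pb), (h0 - c1); split.
  + exact: whomogD.
  + exact: regB.
  rewrite (ddxB Dh0 Dc1) (ddyB Dh0 Dc1) c1x c1y !subr0 (scalerBr n%:~R) nc1.
  by rewrite opprB addrCA [X in _ = _ + X]addrCA.
Qed.

Variables (r : nat) (e : 'I_r -> poly2).
Hypothesis e_basis : is_basis (quasi_homogeneous w1 w2 k) e.

Theorem boundaries_basis :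
  quot_basis S boundaries
    (fun i : 'I_(r + c) => match fintype.split i with
       | inl i => P (e i * f)
       | inr j => P (monomial K (mu j))
       end).
Proof.
have [e_in e_free e_gen] := e_basis; have [_ mu_free mu_gen] := mu_basis.
set v := fun i : 'I_(r + c) => _.
have sumE (a : 'I_(r + c) -> K) : \sum_i a i *: v i =
    P ((\sum_i a (lshift c i) *: e i) * f) +
    \sum_j a (rshift r j) *: P (monomial K (mu j)).
  rewrite big_split_ord mulr_suml poly_germ_sum; congr (_ + _); apply: eq_bigr => i _.
    by rewrite /v (unsplitK (inl i)) -scalerAl poly_germZ.
  by rewrite /v (unsplitK (inr i)).
have e_whomog (a : 'I_r -> K) : whomog k (\sum_i a i *: e i).
  apply: (big_ind (fun p => whomog k p)) => [m|p q|i _].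
  - by rewrite mpoly.mcoeff0 eqxx.
  - exact: whomogD.
  - exact/whomogZ/quasi_homogeneousP/e_in.
split=> [i|a|g Sg].
- by rewrite /v; case: fintype.split => j; exact: reg_poly.
- rewrite sumE => Ha.
  (* The e_i f and the boundaries all lie in the Jacobian ideal, so reducing modulo it leaves a
     relation among the basis monomials alone. *)
  have a2 j : a (rshift r j) = 0.
    apply: (mu_free (fun j => a (rshift r j))) => {j}.
    have := jacobian_lin (-1)
      (jacobian_mulF (reg_poly (\sum_i a (lshift c i) *: e i))) (boundaries_jacobian Ha).
    by rewrite -poly_germM scaleN1r addKr.
  move: Ha; rewrite [X in _ + X]big1 => [|j _]; last by rewrite a2 scale0r.
  rewrite addr0 => /(wcomp_boundary (e_whomog _)) a1 i.
  rewrite -(splitK i); case: (fintype.split i) => j /=; last exact: a2.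
  exact: (e_free (fun j => a (lshift c j))).
- have [b [A SA [B SB E]]] := mu_gen _ Sg.
  (* What remains of [g] after removing basis monomials is X.f with X = (A, B); the homological
     equation is solved for div X = p + W.h - k h. *)
  have [p [h [hp Sh Eh]]] := homological_equation k (regD (reg_ddx RS SA) (reg_ddy RS SB)).
  have [a Ea] := e_gen p (proj2 (quasi_homogeneousP w1 w2 k p) hp).
  have {}Ea : p = \sum_i a i *: e i by apply/eqP; rewrite -subr_eq0; apply/eqP.
  exists (fun i => match fintype.split i with inl i => a i | inr j => b j end).
  rewrite sumE; under eq_bigr do rewrite (unsplitK (inl _)).
  rewrite [X in P _ + X](eq_bigr (fun j => b j *: P (monomial K (mu j)))) => [|j _]; last first.
    by rewrite (unsplitK (inr j)).
  rewrite -Ea opprD addrCA -E.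
  have Dgx := gderivable_gx K; have Dgy := gderivable_gy K.
  have Dh := reg_derivable RS Sh.
  have DA := reg_derivable RS SA; have DB := reg_derivable RS SB.
  have Dgxh := gderivableM Dgx Dh; have Dgyh := gderivableM Dgy Dh.
  (* For the field X - h W the coboundary is X.f - d h f - (div X) f + (W.h + (w1 + w2) h) f.
     Substituting div X and k = d - w1 - w2 leaves X.f - p f. *)
  exists (A - w1%:R *: (gx * h), B - w2%:R *: (gy * h)) => /=.
    by split=> /=; apply: regB => //; apply: regZ; [exact: (reg_gx RS) | exact: (reg_gy RS)].
  rewrite /action /divergence /= (ddxB DA (gderivableZ _ Dgxh)) (ddyB DB (gderivableZ _ Dgyh)).
  rewrite (ddxZ _ Dgxh) (ddyZ _ Dgyh) (ddxM Dgx Dh) (ddyM Dgy Dh) ddx_gx ddy_gy.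
  have -> : (A - w1%:R *: (gx * h)) * ddx F + (B - w2%:R *: (gy * h)) * ddy F -
      (ddx A - w1%:R *: (1 * h + gx * ddx h) +
        (ddy B - w2%:R *: (1 * h + gy * ddy h))) * F =
      A * ddx F + B * ddy F - h * (w1%:R *: (gx * ddx F) + w2%:R *: (gy * ddy F)) -
      (ddx A + ddy B) * F +
      (w1%:R *: (1 * h + gx * ddx h) + w2%:R *: (1 * h + gy * ddy h)) * F.
    by rewrite !scale_germE; ring.
  rewrite euler_germ Eh poly_germM !rmorphB /= -!pmulrn !scale_germE !germ_of_cstB.
  by ring.
Qed.

End RegularClass.

(** * Analytic germs *)

Section DoubleSeries.
Variable K : numFieldType.
Local Notation half n := (2^-1 ^+ n : K).
Local Notation quarter n := (4^-1 ^+ n : K).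

(** The archimedean property and completeness along geometric sequences let one set of norm
    estimates serve both R and C. The factor 4 in the rate is 2 for real sequences, doubled when
    real and imaginary parts are estimated separately. *)
Hypothesis half_small : forall e : K, 0 < e -> exists n, half n < e.
Hypothesis geometric_cvg : forall (u : nat -> K) (B : K),
  (forall n, `|u n.+1 - u n| <= B * half n) ->
  exists l, forall n, `|u n - l| <= 4 * B * half n.

Implicit Types (t : nat -> nat -> K) (l B M : K).

Definition psum t I J := \sum_(i < I) \sum_(j < J) t i j.

(* Convergence along all rectangles at a geometric rate: unlike the convergence
   of square partial sums, it is invariant under shifts of one index. *)
Definition hasum t l := exists M, forall n I J, (n <= I)%N -> (n <= J)%N ->
  `|psum t I J - l| <= M * half n.

Definition dominated t B := forall i j, `|t i j| <= B * quarter (i + j).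

Lemma half_gt0 n : 0 < half n. Proof. by rewrite exprn_gt0 // invr_gt0. Qed.
Lemma quarter_gt0 n : 0 < quarter n. Proof. by rewrite exprn_gt0 // invr_gt0. Qed.

Lemma quarter_le_half n : quarter n <= half n.
Proof.
by rewrite lerXn2r ?nnegrE ?invr_ge0 // lef_pV2 ?posrE // ler_nat.
Qed.

Lemma eq_hasum t t' l : (forall i j, t i j = t' i j) -> hasum t l -> hasum t' l.
Proof. by move=> E; have -> : t' = t by apply/funext => i; apply/funext => j. Qed.

Lemma hasum_lin c t t' l l' : hasum t l -> hasum t' l' ->
  hasum (fun i j => c * t i j + t' i j) (c * l + l').
Proof.
move=> [M H] [M' H']; exists (`|c| * M + M') => n I J nI nJ.
have -> : psum (fun i j => c * t i j + t' i j) I J - (c * l + l') =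
    c * (psum t I J - l) + (psum t' I J - l').
  rewrite /psum; under eq_bigr do rewrite big_split -mulr_sumr /=.
  by rewrite big_split -mulr_sumr /=; ring.
rewrite (le_trans (ler_normD _ _)) // mulrDl lerD ?H' // normrM -mulrA.
by rewrite ler_wpM2l ?H.
Qed.

Lemma hasum0 : hasum (fun _ _ => 0) 0.
Proof.
exists 0 => n I J _ _; rewrite /psum big1 ?subr0 ?normr0 ?mul0r // => i _.
by rewrite big1.
Qed.

Lemma hasumZ c t l : hasum t l -> hasum (fun i j => c * t i j) (c * l).
Proof.
move=> H; have := hasum_lin c H hasum0; rewrite addr0.
by apply: eq_hasum => i j; rewrite addr0.
Qed.

Lemma hasumD t t' l l' : hasum t l -> hasum t' l' ->
  hasum (fun i j => t i j + t' i j) (l + l').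
Proof.
move=> H H'; have := hasum_lin 1 H H'; rewrite mul1r.
by apply: eq_hasum => i j; rewrite mul1r.
Qed.

Lemma hasum_swap t l : hasum t l -> hasum (fun i j => t j i) l.
Proof.
move=> [M H]; exists M => n I J nI nJ.
by rewrite /psum exchange_big; exact: H.
Qed.

Definition shift1 t i j := if i is i'.+1 then t i' j else 0.

Lemma hasum_ge0_const t l M :
  (forall n I J, (n <= I)%N -> (n <= J)%N -> `|psum t I J - l| <= M * half n) -> 0 <= M.
Proof.
by move=> H; have := H 0 0 0 erefl erefl; rewrite expr0 mulr1; exact: le_trans.
Qed.

(** The shifted rectangle lags by one row, which costs one factor 1/2 in the rate; doubling the
    constant pays for it. *)
Lemma hasum_shift1 t l : hasum t l -> hasum (shift1 t) l.
Proof.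
move=> [M H]; have M0 := hasum_ge0_const H.
have l0 : `|l| <= M.
  by have := H 0 0 0 erefl erefl; rewrite /psum big_ord0 sub0r normrN expr0 mulr1.
exists (2 * M) => n [|I] J nI nJ.
  move: nI; rewrite leqn0 => /eqP ->; rewrite /psum big_ord0 sub0r normrN expr0 mulr1.
  by rewrite (le_trans l0) // ler_peMl // ler1n.
have -> : psum (shift1 t) I.+1 J = psum t I J by rewrite /psum big_ord_recl /= big1 ?add0r.
case: n nI nJ => [|n] nI nJ.
  by rewrite (le_trans (H 0 I J _ _)) // expr0 !mulr1 ler_peMl // ler1n.
by rewrite exprS mulrACA mulfV ?pnatr_eq0 // mul1r; apply: H => //; exact: ltnW.
Qed.

Lemma hasum_unique t l l' : hasum t l -> hasum t l' -> l = l'.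
Proof.
move=> [M H] [M' H']; apply/eqP; rewrite -subr_eq0 -normr_le0.
have M0 := hasum_ge0_const H; have M0' := hasum_ge0_const H'.
have [//|gt0] : `|l - l'| <= 0 \/ 0 < `|l - l'|.
  by case: (eqVneq (l - l') 0) => [->|?]; [left; rewrite normr0 | right; rewrite normr_gt0].
have pos : 0 < M + M' + 1 by rewrite ltr_wpDl // addr_ge0.
have [n] := half_small (divr_gt0 gt0 pos).
rewrite ltr_pdivlMr // => lt.
have : `|l - l'| <= (M + M') * half n.
  have -> : l - l' = - (psum t n n - l) + (psum t n n - l') by ring.
  by rewrite (le_trans (ler_normD _ _)) // normrN mulrDl lerD ?H ?H'.
move/(lt_le_trans lt); rewrite mulrC ltr_pM2r ?half_gt0 //.
by rewrite gtrDl ltr10.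
Qed.

Lemma quarter_sum m n :
  (m <= n)%N -> \sum_(m <= i < n) quarter i <= 2 * quarter m.
Proof.
move=> mn.
have -> : \sum_(m <= i < n) quarter i = 3^-1 * 4 * (quarter m - quarter n).
  elim: n mn => [|n IH]; first by rewrite leqn0 => /eqP ->; rewrite big_geq // subrr mulr0.
  rewrite leq_eqVlt => /predU1P[->|mn]; first by rewrite big_geq // subrr mulr0.
  by rewrite big_nat_recr //= IH // exprS; field.
have q0 := ltW (quarter_gt0 n); have q0' := ltW (quarter_gt0 m).
apply: (@le_trans _ _ (3^-1 * 4 * quarter m)).
  by rewrite ler_wpM2l ?mulr_ge0 ?invr_ge0 // lerBlDr lerDl.
by rewrite ler_wpM2r // ler_pdivrMl // -natrM ler_nat.
Qed.

(** The rectangle minus the square is the union of two strips, and summing a geometric series in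
    each index bounds each strip by 4 B / 4^n. *)
Lemma dominated_rectangle t B n I J : dominated t B -> (n <= I)%N -> (n <= J)%N ->
  `|psum t I J - psum t n n| <= 8 * B * quarter n.
Proof.
move=> H nI nJ.
have B0 : 0 <= B by have := H 0 0; rewrite expr0 mulr1; exact: le_trans.
have rect a b c d : (a <= b)%N -> (c <= d)%N ->
    `|\sum_(a <= i < b) \sum_(c <= j < d) t i j| <= 4 * B * quarter (a + c).
  move=> ab cd; rewrite (le_trans (ler_norm_sum _ _ _)) //.
  apply: (@le_trans _ _ (\sum_(a <= i < b) (2 * B * quarter c) * quarter i)).
    apply: ler_sum => i _; rewrite (le_trans (ler_norm_sum _ _ _)) //.
    apply: (@le_trans _ _ (\sum_(c <= j < d) (B * quarter i) * quarter j)).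
      by apply: ler_sum => j _; rewrite -mulrA -exprD; exact: H.
    rewrite -mulr_sumr (le_trans (ler_wpM2l _ (quarter_sum cd))) //.
      by rewrite mulr_ge0 // ltW ?quarter_gt0.
    by rewrite le_eqVlt; apply/orP; left; apply/eqP; ring.
  rewrite -mulr_sumr (le_trans (ler_wpM2l _ (quarter_sum ab))) //.
    by rewrite !mulr_ge0 // ltW ?quarter_gt0.
  by rewrite le_eqVlt; apply/orP; left; apply/eqP; rewrite exprD; ring.
have -> : psum t I J - psum t n n =
    \sum_(0 <= i < I) \sum_(n <= j < J) t i j + \sum_(n <= i < I) \sum_(0 <= j < n) t i j.
  have E : psum t I J = \sum_(0 <= i < I) \sum_(n <= j < J) t i j +
      \sum_(0 <= i < I) \sum_(0 <= j < n) t i j.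
    rewrite /psum -(big_mkord predT (fun i => \sum_(j < J) t i j)) -big_split.
    apply: eq_bigr => i _ /=; rewrite -(big_mkord predT (t i)) addrC.
    by rewrite (@big_cat_nat _ _ _ n).
  have -> : psum t n n = \sum_(0 <= i < n) \sum_(0 <= j < n) t i j.
    rewrite big_mkord; apply: eq_bigr => i _; by rewrite big_mkord.
  rewrite E (@big_cat_nat _ _ _ n 0 I predT (fun i => \sum_(0 <= j < n) t i j)) //=.
  by ring.
rewrite (le_trans (ler_normD _ _)) // (le_trans (lerD (rect _ _ _ _ _ _) (rect _ _ _ _ _ _))) //.
by rewrite addn0 add0n le_eqVlt; apply/orP; left; apply/eqP; ring.
Qed.

(** The constant 40 is 8 from rectangle to square plus 4 times 8 from the squares to their limit.
    Its being explicit gives a bound on the sum that is linear in [B], as differentiation needs. *)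
Lemma dominated_hasum_bound t B : dominated t B -> exists l,
  forall n I J, (n <= I)%N -> (n <= J)%N -> `|psum t I J - l| <= 40 * B * half n.
Proof.
move=> H.
have B0 : 0 <= B by have := H 0 0; rewrite expr0 mulr1; exact: le_trans.
have B8 : 0 <= 8 * B by rewrite mulr_ge0.
have [|l Hl] := @geometric_cvg (fun n => psum t n n) (8 * B).
  move=> n; apply: (le_trans (dominated_rectangle H (leqnSn n) (leqnSn n))).
  by rewrite ler_wpM2l // quarter_le_half.
exists l => n I J nI nJ.
have -> : psum t I J - l = (psum t I J - psum t n n) + (psum t n n - l) by ring.
rewrite (le_trans (ler_normD _ _)) //.
apply: (@le_trans _ _ (8 * B * half n + 4 * (8 * B) * half n)).
  rewrite lerD // (le_trans (dominated_rectangle H nI nJ)) //.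
  by rewrite ler_wpM2l // quarter_le_half.
by rewrite le_eqVlt; apply/orP; left; apply/eqP; ring.
Qed.

Lemma dominated_hasum t B : dominated t B -> exists l, hasum t l.
Proof. by move=> /dominated_hasum_bound[l H]; exists l, (40 * B). Qed.

Lemma dominated_norm_le t B l : dominated t B -> hasum t l -> `|l| <= 40 * B.
Proof.
move=> /dominated_hasum_bound[l' H'] H.
have -> : l = l' by apply: hasum_unique H _; exists (40 * B).
by have := H' 0 0 0 erefl erefl; rewrite /psum big_ord0 sub0r normrN expr0 mulr1.
Qed.

Lemma hasum_cvg t l : hasum t l -> (fun n => psum t n n) @ \oo --> l.
Proof.
move=> [M H]; have M0 := hasum_ge0_const H.
apply/cvgrPdist_lt => e e0.
have pos : 0 < M + 1 by rewrite ltr_wpDl.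
have [N] := half_small (divr_gt0 e0 pos).
rewrite ltr_pdivlMr // => lt.
exists N => // n /= Nn; rewrite distrC (le_lt_trans (H _ _ _ Nn Nn)) //.
apply: le_lt_trans lt; rewrite mulrC ler_wpM2l ?lerDl //.
Qed.

Implicit Types (a b : nat -> nat -> K) (f g : K * K -> K) (p : K * K).

(** Positive radius of convergence expressed on the coefficients alone, hence easy to transport
    through shifts, derivatives and divisions. *)
Definition geometric_bound a :=
  exists (M s : K), 0 < s /\ forall i j, `|a i j| <= M * s ^+ (i + j).

Definition term a p i j := a i j * p.1 ^+ i * p.2 ^+ j.

Definition is_pseries a f := geometric_bound a /\
  \forall p \near (0 : K * K), hasum (term a p) (f p).

Lemma near0_box (r : K) : 0 < r ->
  \forall p \near (0 : K * K), `|p.1| < r /\ `|p.2| < r.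
Proof.
move=> r0; have H : \forall x \near (0 : K), `|x| < r.
  by apply/nbhs_normP; exists r => //= x /=; rewrite sub0r normrN.
by exists ([set x | `|x| < r], [set x | `|x| < r]).
Qed.

Lemma geometric_bound_near a : geometric_bound a ->
  exists M, \forall p \near (0 : K * K), dominated (term a p) M.
Proof.
move=> [M [s [s0 H]]]; exists M.
have s40 : 0 < (4 * s)^-1 by rewrite invr_gt0 mulr_gt0.
apply: filterS (near0_box s40) => p [px py] i j.
have -> : quarter (i + j) = s ^+ (i + j) * (4 * s)^-1 ^+ (i + j).
  by rewrite -exprMn; congr (_ ^+ _); field; rewrite ?gt_eqF.
rewrite /term !normrM !normrX mulrA -[X in X <= _]mulrA [X in _ <= _ * X]exprD.
by rewrite !ler_pM ?mulr_ge0 ?exprn_ge0 ?normr_ge0 // lerXn2r ?nnegrE ?normr_ge0 ?ltW.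
Qed.

(** Where the series has no sum the function takes the default value 0; only its germ matters. *)
Lemma pseries_exists a : geometric_bound a -> exists f, is_pseries a f.
Proof.
move=> Ha; exists (fun p => xget 0 [set l | hasum (term a p) l]); split=> //.
have [M H] := geometric_bound_near Ha.
apply: filterS H => p /dominated_hasum[l Hl].
by apply: (@xgetPex _ 0 [set l | hasum (term a p) l]); exists l.
Qed.

Lemma geometric_bound_lin c a b : geometric_bound a -> geometric_bound b ->
  geometric_bound (fun i j => c * a i j + b i j).
Proof.
move=> [M [s [s0 H]]] [M' [s' [s0' H']]].
have M0 : 0 <= M by have := H 0 0; rewrite expr0 mulr1; exact: le_trans.
have M0' : 0 <= M' by have := H' 0 0; rewrite expr0 mulr1; exact: le_trans.
exists (`|c| * M + M'), (s + s'); split=> [|i j]; first exact: addr_gt0.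
rewrite (le_trans (ler_normD _ _)) // mulrDl normrM -mulrA.
have le1 : s ^+ (i + j) <= (s + s') ^+ (i + j).
  by rewrite lerXn2r ?nnegrE ?addr_ge0 ?lerDl // ltW.
have le2 : s' ^+ (i + j) <= (s + s') ^+ (i + j).
  by rewrite lerXn2r ?nnegrE ?addr_ge0 ?lerDr // ltW.
rewrite lerD ?ler_wpM2l //.
  by rewrite (le_trans (H i j)) // ler_wpM2l.
by rewrite (le_trans (H' i j)) // ler_wpM2l.
Qed.

Lemma is_pseries_lin c a b f g : is_pseries a f -> is_pseries b g ->
  is_pseries (fun i j => c * a i j + b i j) (fun p => c * f p + g p).
Proof.
move=> [Ba Hf] [Bb Hg]; split; first exact: geometric_bound_lin.
apply: filterS2 Hf Hg => p Hf Hg.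
by apply: eq_hasum (hasum_lin c Hf Hg) => i j; rewrite /term; ring.
Qed.

Lemma geometric_bound_shift1 a : geometric_bound a -> geometric_bound (shift1 a).
Proof.
move=> [M [s [s0 H]]]; exists (M / s), s; split=> // -[|i] j /=.
  have M0 : 0 <= M by have := H 0 0; rewrite expr0 mulr1; exact: le_trans.
  by rewrite normr0 !mulr_ge0 ?invr_ge0 ?exprn_ge0 // ltW.
by rewrite addSn exprS mulrA mulfVK ?gt_eqF.
Qed.

Lemma is_pseries_mulx a f :
  is_pseries a f -> is_pseries (shift1 a) (fun p => p.1 * f p).
Proof.
move=> [Ba Hf]; split; first exact: geometric_bound_shift1.
apply: filterS Hf => p Hf.
apply: eq_hasum (hasum_shift1 (hasumZ p.1 Hf)) => -[|i] j; rewrite /term /=.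
  by rewrite !mul0r.
by rewrite exprS; ring.
Qed.

(** Exchanging the coordinates reduces statements about y to those about x. *)
Definition swap p : K * K := (p.2, p.1).

Lemma near0_swap (Q : K * K -> Prop) : (\forall p \near (0 : K * K), Q p) ->
  \forall p \near (0 : K * K), Q (swap p).
Proof. by move=> [[A B] /= [nA nB] AB]; exists (B, A) => // -[x y] [/= Bx Ay]; exact: AB. Qed.

Lemma is_pseries_swap a f :
  is_pseries a f -> is_pseries (fun i j => a j i) (f \o swap).
Proof.
move=> [[M [s [s0 H]]] Hf]; split; first by exists M, s; split=> // i j; rewrite addnC.
apply: filterS (near0_swap Hf) => p Hp.
by apply: eq_hasum (hasum_swap Hp) => i j; rewrite /term /= mulrAC.
Qed.

Definition deriv1 a i j := i.+1%:R * a i.+1 j.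

(** The factor i + 1 is at most 2^i, so doubling the rate absorbs it. *)
Lemma geometric_bound_deriv1 a : geometric_bound a -> geometric_bound (deriv1 a).
Proof.
move=> [M [s [s0 H]]]; exists (M * s), (2 * s); split=> [|i j]; first exact: mulr_gt0.
have M0 : 0 <= M by have := H 0 0; rewrite expr0 mulr1; exact: le_trans.
rewrite /deriv1 normrM normr_nat exprMn mulrCA ler_pM //.
  rewrite -natrX ler_nat (leq_trans (ltn_expl i (isT : 1 < 2)%N)) //.
  by rewrite leq_exp2l // leq_addr.
by rewrite (le_trans (H _ _)) // addSn exprS mulrA.
Qed.

(** The remainder R_n satisfies R_(n+1) = z R_n + (z - x)^2 n x^(n-1), and r (4r)^n + 3r (4r)^n =
    (4r)^(n+1) closes the induction. This purely algebraic Taylor estimate serves R and C alike. *)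
Lemma quadratic_remainder (r x z : K) n : `|x| <= r -> `|z| <= r ->
  `|z ^+ n - x ^+ n - (z - x) * (n%:R * x ^+ n.-1)| * r ^+ 2 <=
    `|z - x| ^+ 2 * (4 * r) ^+ n.
Proof.
move=> xr zr; have r0 : 0 <= r by exact: le_trans xr.
elim: n => [|n IH].
  by rewrite !expr0 subrr mul0r mulr0 subrr normr0 mul0r mulr1 exprn_ge0.
have -> : z ^+ n.+1 - x ^+ n.+1 - (z - x) * (n.+1%:R * x ^+ n) =
    z * (z ^+ n - x ^+ n - (z - x) * (n%:R * x ^+ n.-1)) +
    (z - x) ^+ 2 * (n%:R * x ^+ n.-1).
  case: n {IH} => [|n] /=; first by rewrite !expr0 !expr1; ring.
  by rewrite -[n.+2%:R]natr1 !exprS; ring.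
rewrite (le_trans (ler_wpM2r _ (ler_normD _ _))) ?exprn_ge0 // mulrDl.
have -> : `|z - x| ^+ 2 * (4 * r) ^+ n.+1 =
    r * (`|z - x| ^+ 2 * (4 * r) ^+ n) + `|z - x| ^+ 2 * (3 * r * (4 * r) ^+ n).
  by rewrite (exprS (4 * r)); ring.
apply: lerD; first by rewrite normrM -mulrA ler_pM ?mulr_ge0 ?exprn_ge0.
rewrite normrM normrX -mulrA ler_wpM2l ?exprn_ge0 // normrM normr_nat normrX.
case: n {IH} => [|n] /=; first by rewrite !mul0r !mulr_ge0 // expr0.
have -> : 3 * r * (4 * r) ^+ n.+1 = 3 * 4 ^+ n.+1 * r ^+ n * r ^+ 2.
  by rewrite exprMn !exprS; ring.
rewrite ler_wpM2r ?exprn_ge0 // ler_pM ?exprn_ge0 //; last first.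
  by rewrite lerXn2r ?nnegrE.
rewrite -natrX -natrM ler_nat (leq_trans (ltnW (ltn_expl n.+1 (isT : 1 < 4)%N))) //.
by rewrite leq_pmull.
Qed.

Lemma is_derive_quadratic (F : K -> K) (x D C : K) :
  (\forall z \near x, `|F z - F x - (z - x) * D| <= C * `|z - x| ^+ 2) ->
  is_derive x 1 F D.
Proof.
move=> H; have C0 : 0 <= `|C| + 1 by rewrite addr_ge0.
suff cv : h^-1 *: ((F \o shift x) (h *: (1 : K)) - F x) @[h --> 0^'] --> D.
  by apply: DeriveDef; [apply/cvg_ex; exists D | exact: cvg_lim].
apply/cvgrPdist_lt => e e0.
have Hh : \forall h \near (0 : K)^', `|F (h + x) - F x - h * D| <= C * `|h| ^+ 2.
  move: H => /nbhs_normP[d /= d0 Hd].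
  apply/nbhs_normP; exists d => //= h hd _.
  have := Hd (h + x); rewrite /= addrK opprD addrCA subrr addr0.
  by apply; move: hd; rewrite /= sub0r.
have small : \forall h \near (0 : K)^', `|h| < e / (`|C| + 1).
  apply/nbhs_normP; exists (e / (`|C| + 1)) => /=; first by rewrite divr_gt0 // ltr_wpDl.
  by move=> h /=; rewrite sub0r normrN.
near=> h.
have h0 : h != 0 by near: h; exact: nbhs_dnbhs_neq.
have nh0 : 0 < `|h| by rewrite normr_gt0.
rewrite -(ltr_pM2l nh0) -normrM mulrBr.
have -> : h * (h^-1 *: ((F \o shift x) (h *: (1 : K)) - F x)) = F (h + x) - F x.
  by rewrite /= -[h *: _]/(h * 1) mulr1 -[h^-1 *: _]/(h^-1 * _) mulrA mulfV // mul1r.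
rewrite distrC.
have h1 : `|F (h + x) - F x - h * D| <= C * `|h| ^+ 2 by near: h.
have h2 : `|h| < e / (`|C| + 1) by near: h.
apply: (le_lt_trans h1); rewrite expr2 mulrCA ltr_pM2l //.
rewrite ltr_pdivlMr in h2; last by rewrite ltr_wpDl.
have C1 : 0 <= C.
  by rewrite -(pmulr_lge0 _ (exprn_gt0 2 nh0)); exact: le_trans h1.
by apply: le_lt_trans h2; rewrite mulrC ler_wpM2l // ger0_norm // lerDl.
Unshelve. all: by end_near. Qed.


(** Termwise differentiation. With g the sum of the derived series, f(z, y) - f(x, y) - (z - x) g(x,
    y) is the sum of the quadratic remainders of the terms, a series dominated by a multiple of |z -
    x|^2. *)
Lemma is_pseries_dx a f : is_pseries a f ->
  is_pseries (deriv1 a) (dx f) /\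
  \forall p \near (0 : K * K), derivable (fun t : K => f (t, p.2)) p.1 1.
Proof.
move=> [Ba Hf]; have [g [Bg Hg]] := pseries_exists (geometric_bound_deriv1 Ba).
have [M [s [s0 H]]] := Ba.
have M0 : 0 <= M by have := H 0 0; rewrite expr0 mulr1; exact: le_trans.
(* The remainder estimate inflates r to 4 r; this radius makes s (4 r) = 1/4, the ratio required by
   [dominated]. *)
pose r := (16 * s)^-1; have r0 : 0 < r by rewrite invr_gt0 mulr_gt0.
have D : \forall p \near (0 : K * K), is_derive (p.1 : K) (1 : K) (fun t : K => f (t, p.2)) (g p).
  have N := near_slices Hf; have N' := near_slices (near0_box r0).
  apply: filterS2 (filterI (near0_box r0) Hf) (filterI Hg (filterI N N')).
  move=> [x y] [/= [xr yr] Hfp] [Hgp [[/= Hfz _] [/= zr _]]].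
  apply: (@is_derive_quadratic _ _ _ (40 * (M / r ^+ 2))).
  apply: filterS2 Hfz zr => z Hfz [zr _].
  pose q i j := a i j * (z ^+ i - x ^+ i - (z - x) * (i%:R * x ^+ i.-1)) * y ^+ j.
  have Hq : hasum q (f (z, y) - f (x, y) - (z - x) * g (x, y)).
    have -> : f (z, y) - f (x, y) - (z - x) * g (x, y) =
      -1 * f (x, y) + f (z, y) + - (z - x) * g (x, y) by ring.
    (* Shifting the derived series by one row aligns its terms i a_ij x^(i-1) y^j with those of
       [f]. *)
    apply: eq_hasum (hasumD (hasum_lin (-1) Hfp Hfz) (hasumZ (- (z - x)) (hasum_shift1 Hgp))).
    move=> [|i] j; rewrite /q /term /shift1 /deriv1 /=; first by rewrite !expr0; ring.
    by ring.
  have Dq : dominated q (M / r ^+ 2 * `|z - x| ^+ 2).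
    move=> i j; rewrite /q !normrM normrX.
    have rE : 16 * s * r = 1 by rewrite /r mulfV // gt_eqF ?mulr_gt0.
    have -> : quarter (i + j) = s ^+ (i + j) * (4 * r) ^+ i * (4 * r) ^+ j.
      rewrite -mulrA -!exprD -exprMn; congr (_ ^+ _).
      by apply: (@mulfI _ 4); rewrite ?pnatr_eq0 // mulfV ?pnatr_eq0 // -[LHS]rE; ring.
    have h1 := quadratic_remainder i (ltW xr) (ltW zr).
    have h2 : `|y| ^+ j <= (4 * r) ^+ j.
      rewrite lerXn2r ?nnegrE ?mulr_ge0 ?(ltW r0) //.
      by rewrite (le_trans (ltW yr)) // ler_peMl ?ler1n // ltW.
    have -> : M / r ^+ 2 * `|z - x| ^+ 2 * (s ^+ (i + j) * (4 * r) ^+ i * (4 * r) ^+ j) =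
      M * s ^+ (i + j) * (`|z - x| ^+ 2 * (4 * r) ^+ i / r ^+ 2) * (4 * r) ^+ j.
      by ring.
    rewrite ler_pM ?mulr_ge0 ?exprn_ge0 // ler_pM //.
    by rewrite ler_pdivlMr // exprn_gt0.
  by have := dominated_norm_le Dq Hq; rewrite mulrA.
split; last by apply: filterS D => p Dp; exact: ex_derive.
split; first exact: geometric_bound_deriv1.
by apply: filterS2 D Hg => p Dp; rewrite /dx derive1E derive_val.
Qed.

Lemma is_pseries_dy a f : is_pseries a f ->
  is_pseries (fun i j => j.+1%:R * a i j.+1) (dy f) /\
  \forall p \near (0 : K * K), derivable (fun t : K => f (p.1, t)) p.2 1.
Proof.
move=> Hf; have [H D] := is_pseries_dx (is_pseries_swap Hf).
split; last exact: near0_swap D.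
have -> : dy f = dx (f \o swap) \o swap by apply/funext => -[x y].
exact: is_pseries_swap H.
Qed.

Lemma is_pseries_muly a f : is_pseries a f ->
  is_pseries (fun i j => shift1 (fun i' j' => a j' i') j i) (fun p => p.2 * f p).
Proof.
move=> Hf; have H := is_pseries_swap (is_pseries_mulx (is_pseries_swap Hf)).
have -> : (fun p => p.2 * f p) = (fun p => p.1 * (f \o swap) p) \o swap.
  by apply/funext => -[x y].
exact: H.
Qed.

Definition monomial0 (c : K) i j := if (i + j == 0)%N then c else 0.

Lemma is_pseries_cst c : is_pseries (monomial0 c) (cst c).
Proof.
split.
  exists `|c|, 1; split=> // i j; rewrite expr1n mulr1 /monomial0.
  by case: ifP; rewrite ?normr0.
apply: near0W => p; exists `|c| => n [|I] [|J] nI nJ.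
- move: nI; rewrite leqn0 => /eqP ->; by rewrite /psum big_ord0 sub0r normrN mulr1.
- move: nI; rewrite leqn0 => /eqP ->; by rewrite /psum big_ord0 sub0r normrN mulr1.
- move: nJ; rewrite leqn0 => /eqP ->; rewrite /psum big1 ?sub0r ?normrN ?mulr1 // => i _.
  by rewrite big_ord0.
- have -> : psum (term (monomial0 c) p) I.+1 J.+1 = c.
    rewrite /psum big_ord_recl /= big_ord_recl /= /term /monomial0 /= !mulr1.
    rewrite [X in _ + X + _]big1 ?addr0 => [|j _]; last by rewrite !mul0r.
    by rewrite big1 ?addr0 // => i _; rewrite big1 // => j _; rewrite !mul0r.
  by rewrite subrr normr0 mulr_ge0 // ltW ?half_gt0.
Qed.

Lemma geometric_bound_ge0 a : geometric_bound a ->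
  exists (M s : K), [/\ 0 <= M, 0 < s & forall i j, `|a i j| <= M * s ^+ (i + j)].
Proof.
move=> [M [s [s0 H]]]; exists M, s; split=> //.
by have := H 0 0; rewrite expr0 mulr1; exact: le_trans.
Qed.

Lemma is_pseries_hadamard a f : is_pseries a f -> exists c b b' g g',
  [/\ is_pseries b g, is_pseries b' g' &
      \forall p \near (0 : K * K), f p = c + (p.1 * g p + p.2 * g' p)].
Proof.
move=> [Ba Hf]; have [M [s [M0 s0 H]]] := geometric_bound_ge0 Ba.
(* [b] collects the monomials divisible by x, and [b'] the pure powers of y of positive degree. *)
pose b i j := a i.+1 j; pose b' i j := if i is 0 then a 0 j.+1 else 0.
have Bb : geometric_bound b.
  exists (M * s), s; split=> // i j.
  by rewrite -mulrA -exprS -addSn; exact: H.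
have Bb' : geometric_bound b'.
  exists (M * s), s; split=> // -[|i] j /=.
    by rewrite -mulrA -exprS; exact: (H 0 j.+1).
  by rewrite normr0 !mulr_ge0 ?exprn_ge0 // ltW.
have [g Hg] := pseries_exists Bb; have [g' Hg'] := pseries_exists Bb'.
exists (a 0 0), b, b', g, g'; split=> //.
have [_ Hs] := is_pseries_lin 1 (is_pseries_mulx Hg) (is_pseries_muly Hg').
have [_ Hc] := is_pseries_cst (a 0 0).
apply: filterS2 Hf (filterI Hs Hc) => p Hf [{}Hs {}Hc].
have -> : a 0 0 + (p.1 * g p + p.2 * g' p) = a 0 0 + (1 * (p.1 * g p) + (p.2 * g' p)) by ring.
apply: hasum_unique Hf _; apply: eq_hasum (hasumD Hc Hs).
by move=> [|i] [|j]; rewrite /term /monomial0 /shift1 /b /b' /=; ring.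
Qed.

Lemma is_pseries_solve (w1 w2 n : nat) a f : is_pseries a f -> exists b h,
  is_pseries b h /\ \forall p \near (0 : K * K),
    w1%:R * (p.1 * dx h p) + w2%:R * (p.2 * dy h p) + n.+1%:R * h p = f p.
Proof.
move=> [Ba Hf]; have [M [s [M0 s0 H]]] := geometric_bound_ge0 Ba.
(* The operator multiplies x^i y^j by this integer, which is at least 1, so the quotient
   coefficients obey the same geometric bound. *)
pose b i j := a i j / (w1 * i + w2 * j + n.+1)%:R.
have Bb : geometric_bound b.
  exists M, s; split=> // i j; rewrite /b normrM normfV normr_nat addnS.
  by rewrite ler_pdivrMr // (le_trans (H i j)) // ler_peMr ?ler1n // mulr_ge0 ?exprn_ge0 // ltW.
have [h Hh] := pseries_exists Bb; exists b, h; split=> //.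
have [Hx _] := is_pseries_dx Hh; have [Hy _] := is_pseries_dy Hh.
(* The zero constant series terminates the nested combinations c a + b. *)
have Hs := is_pseries_lin w1%:R (is_pseries_mulx Hx)
   (is_pseries_lin w2%:R (is_pseries_muly Hy)
     (is_pseries_lin n.+1%:R Hh (is_pseries_cst 0))).
apply: filterS2 Hf (proj2 Hs) => p Hf {}Hs.
rewrite -addrA; rewrite -[n.+1%:R * h p]addr0; apply: hasum_unique _ Hf; apply: eq_hasum Hs.
move=> i j; rewrite /term; congr (_ * _ * _).
have -> : a i j = (w1 * i + w2 * j + n.+1)%:R * b i j.
  by rewrite /b mulrC mulfVK // pnatr_eq0 addnS.
rewrite !natrD !natrM /monomial0 if_same addr0 !mulrDl -!mulrA addrA.
congr (_ * _ + _ * _ + _).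
  by case: i => [|k]; rewrite /= ?mul0r.
by case: j => [|k]; rewrite /= ?mul0r.
Qed.

(** Absolute convergence at the single point (rho / 2, rho / 2) bounds every term there, hence the
    coefficients geometrically; the limits along squares and along rectangles then agree.
    Conversely, domination of the absolute values bounds all square sums. *)
Lemma analytic0P f : analytic0 f <-> exists a, is_pseries a f.
Proof.
split=> [[a [rho [rho0 H]]]|[a [Ba Hf]]]; exists a.
  have Ba : geometric_bound a.
    have r0 : 0 < rho / 2 by rewrite divr_gt0.
    have rr : `|rho / 2| < rho by rewrite gtr0_norm // ltr_pdivrMr // ltr_pMr // ltr1n.
    have [[M HM] _] := H (rho / 2, rho / 2) rr rr.
    exists M, (rho / 2)^-1; split=> [|i j]; first by rewrite invr_gt0.
    rewrite exprVn ler_pdivlMr ?exprn_gt0 //; apply: le_trans (HM (i + j).+1).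
    have li : (i < (i + j).+1)%N by rewrite ltnS leq_addr.
    have lj : (j < (i + j).+1)%N by rewrite ltnS leq_addl.
    rewrite (bigD1 (Ordinal li)) //= (bigD1 (Ordinal lj)) //= -addrA.
    rewrite !normrM !normrX (gtr0_norm r0) exprD mulrA lerDl addr_ge0 // sumr_ge0 // => k _.
    exact: sumr_ge0.
  split=> //; have [M HM] := geometric_bound_near Ba.
  apply: filterS2 HM (near0_box rho0) => p /dominated_hasum[l Hl] [px py].
  suff -> : f p = l by [].
  have [_ cf] := H p px py.
  exact: (cvg_unique _ cf (hasum_cvg Hl)).
have [M HM] := geometric_bound_near Ba.
have /nbhs_ballP[rho /= rho0 Hr] : \forall p \near (0 : K * K),
    dominated (term a p) M /\ hasum (term a p) (f p).
  exact: filterI.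
exists rho; split=> // p px py.
have [dom sum] : dominated (term a p) M /\ hasum (term a p) (f p).
  by apply: Hr; split; rewrite /ball /= sub0r normrN.
split; last exact: hasum_cvg sum.
have {}dom : dominated (fun i j => `|term a p i j|) M by move=> i j; rewrite normr_id.
exists (8 * M) => n; have := dominated_rectangle dom (leq0n n) (leq0n n).
rewrite [psum _ 0 0]big_ord0 subr0 expr0 mulr1; apply: le_trans; apply: real_ler_norm.
by apply: ger0_real; apply: sumr_ge0 => i _; exact: sumr_ge0.
Qed.

Lemma analytic_regular_class (w1 w2 : nat) :
  regular_class w1 w2 (@germ_of K @` @analytic0 K).
Proof.
split.
- move=> c _ _ [f /analytic0P[a Ha] <-] [g /analytic0P[b Hb] <-].
  exists (fun p => c * f p + g p); last by rewrite -germ_ofZ -germ_ofD.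
  by apply/analytic0P; eexists; exact: is_pseries_lin Ha Hb.
- exists (cst 1); last exact: germ_of1.
  by apply/analytic0P; eexists; exact: is_pseries_cst.
- move=> _ [f /analytic0P[a Ha] <-]; exists (fun p => p.1 * f p); last by rewrite -germ_ofM.
  by apply/analytic0P; eexists; exact: is_pseries_mulx Ha.
- move=> _ [f /analytic0P[a Ha] <-]; exists (fun p => p.2 * f p); last by rewrite -germ_ofM.
  by apply/analytic0P; eexists; exact: is_pseries_muly Ha.
- move=> _ [f /analytic0P[a Ha] <-]; apply/gderivableP.
  apply: filterS2 (proj2 (is_pseries_dx Ha)) (proj2 (is_pseries_dy Ha)).
  by move=> p Dx Dy; exact: conj Dx Dy.
- move=> _ [f /analytic0P[a Ha] <-]; rewrite ddx_germ_of; exists (dx f) => //.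
  by apply/analytic0P; eexists; exact: proj1 (is_pseries_dx Ha).
- move=> _ [f /analytic0P[a Ha] <-]; rewrite ddy_germ_of; exists (dy f) => //.
  by apply/analytic0P; eexists; exact: proj1 (is_pseries_dy Ha).
- move=> _ [f /analytic0P[a /is_pseries_hadamard[c [b [b' [g [g' [Hg Hg' E]]]]]]] <-].
  exists c, (germ_of g), (germ_of g'); split.
  + by exists g => //; apply/analytic0P; exists b.
  + by exists g' => //; apply/analytic0P; exists b'.
  rewrite scale_germE mulr1 -!germ_ofM -!germ_ofD; apply/germ_ofP.
  exact: E.
- move=> n _ [f /analytic0P[a /(is_pseries_solve w1 w2 n)[b [h [Hh E]]]] <-].
  exists (germ_of h); first by exists h => //; apply/analytic0P; exists b.
  rewrite ddx_germ_of ddy_germ_of -!germ_ofM -!germ_ofZ -!germ_ofD.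
  exact/germ_ofP.
Qed.

End DoubleSeries.

Arguments swap {K}.

(** * Completeness of R and C along geometric sequences *)

Section GeometricConvergence.
Variable R : realType.

Lemma half_small_real (e : R) : 0 < e -> exists n, 2^-1 ^+ n < e.
Proof.
move=> e0; have c : (GRing.exp (2^-1 : R) : nat -> R) @ \oo --> (0 : R).
  by apply: cvg_expr; rewrite ger0_norm ?invr_ge0 // invf_lt1 ?ltr1n.
move/cvgr0_norm_lt: c => /(_ e e0)[N _ /(_ N (leqnn N))].
rewrite /= ger0_norm ?exprn_ge0 ?invr_ge0 // => H.
by exists N.
Qed.

(** Nested intervals: 2 B / 2^n is the sum of all increments allowed from n on, so the intervals of
    that half-length around [u n] decrease, and the supremum of their left ends lies in each. *)
Lemma geometric_cvg_real (u : nat -> R) (B : R) :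
  (forall n, `|u n.+1 - u n| <= B * 2^-1 ^+ n) ->
  exists l, forall n, `|u n - l| <= 2 * B * 2^-1 ^+ n.
Proof.
move=> H; have B0 : 0 <= B by have := H 0; rewrite expr0 mulr1; exact: le_trans.
pose v n := u n + 2 * B * 2^-1 ^+ n; pose w n := u n - 2 * B * 2^-1 ^+ n.
have half n : 2 * B * 2^-1 ^+ n.+1 = B * 2^-1 ^+ n :> R by rewrite exprS; field.
have vS m n : (m <= n)%N -> v n <= v m.
  move=> /subnKC <-; elim: (n - m)%N => [|k IH]; first by rewrite addn0.
  apply: le_trans IH; rewrite addnS /v half.
  by have := H (m + k)%N; rewrite ler_norml => /andP[_]; lra.
have wS m n : (m <= n)%N -> w m <= w n.
  move=> /subnKC <-; elim: (n - m)%N => [|k IH]; first by rewrite addn0.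
  apply: (le_trans IH); rewrite addnS /w half.
  by have := H (m + k)%N; rewrite ler_norml => /andP[]; lra.
have wv m n : w m <= v n.
  have [mn|/ltnW nm] := leqP m n.
    apply: (le_trans (wS _ _ mn)); rewrite /w /v.
    have : 0 <= 2 * B * 2^-1 ^+ n by rewrite !mulr_ge0 ?exprn_ge0 ?invr_ge0.
    by lra.
  apply: le_trans (vS _ _ nm); rewrite /w /v.
  have : 0 <= 2 * B * 2^-1 ^+ m by rewrite !mulr_ge0 ?exprn_ge0 ?invr_ge0.
  by lra.
exists (sup (range w)) => n.
have h1 : sup (range w) <= v n.
  by apply: ge_sup => [|_ [m _ <-]]; [exists (w 0), 0%N | exact: wv].
have h2 : w n <= sup (range w).
  by apply: ub_le_sup; [exists (v 0) => _ [m _ <-]; exact: wv | exists n].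
by move: h1 h2; rewrite /v /w ler_norml; lra.
Qed.

Lemma analytic_real_regular_class (w1 w2 : nat) :
  regular_class w1 w2 (@germ_of R @` @analytic0 R).
Proof.
apply: analytic_regular_class; first exact: half_small_real.
move=> u B H; have B0 : 0 <= B by have := H 0; rewrite expr0 mulr1; exact: le_trans.
have [l Hl] := geometric_cvg_real H; exists l => n; apply: (le_trans (Hl n)).
by rewrite !ler_wpM2r ?exprn_ge0 ?invr_ge0 // ler_nat.
Qed.

Local Open Scope complex_scope.

Lemma half_complex n : (2^-1 : R[i]) ^+ n = ((2^-1 : R) ^+ n)%:C.
Proof. by rewrite rmorphXn /= fmorphV rmorph_nat. Qed.

Lemma real_of_ge0 (x : R[i]) : 0 <= x -> x = (complex.Re x)%:C.
Proof. by case: x => a b; rewrite lecE /= => /andP[/eqP -> _]. Qed.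

Lemma norm_complex_le (z : R[i]) :
  `|z| <= (`|complex.Re z| + `|complex.Im z|)%:C.
Proof.
rewrite normc_def lecR -[leRHS]ger0_norm ?addr_ge0 // -sqrtr_sqr ler_wsqrtr //.
rewrite sqrrD !real_normK ?num_real //.
by rewrite lerD2r lerDl mulrn_wge0 // mulr_ge0.
Qed.

Lemma Im_le_norm (z : R[i]) : `|complex.Im z|%:C <= `|z|.
Proof.
by rewrite normc_def lecR -sqrtr_sqr ler_wsqrtr // lerDr sqr_ge0.
Qed.

Lemma analytic_complex_regular_class (w1 w2 : nat) :
  regular_class w1 w2 (@germ_of R[i] @` @analytic0 R[i]).
Proof.
apply: analytic_regular_class => [e e0|u B H].
  (* In the order of [R[i]] a positive number is real, so the bounds [e] and [B] reduce to real
     ones. *)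
  have := e0; rewrite (real_of_ge0 (ltW e0)) -[0]/(0%:C) ltcR => /half_small_real[n].
  by rewrite -ltcR -half_complex; exists n.
have B0 : 0 <= B by have := H 0; rewrite expr0 mulr1; exact: le_trans.
set b := complex.Re B; have EB : B = b%:C := real_of_ge0 B0.
have HRe n : `|complex.Re (u n.+1) - complex.Re (u n)| <= b * 2^-1 ^+ n.
  rewrite -lecR rmorphM /= -half_complex -EB; apply: le_trans (H n).
  by rewrite -raddfB; exact: normc_ge_Re.
have HIm n : `|complex.Im (u n.+1) - complex.Im (u n)| <= b * 2^-1 ^+ n.
  rewrite -lecR rmorphM /= -half_complex -EB; apply: le_trans (H n).
  by rewrite -raddfB; exact: Im_le_norm.
have [x Hx] := geometric_cvg_real HRe; have [y Hy] := geometric_cvg_real HIm.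
exists (x +i* y) => n; apply: (le_trans (norm_complex_le _)).
have -> : 4 * B * 2^-1 ^+ n = (2 * b * 2^-1 ^+ n + 2 * b * 2^-1 ^+ n)%:C.
  rewrite EB half_complex -(rmorph_nat (real_complex R)) -!rmorphM /=; congr (_%:C).
  by ring.
rewrite lecR; move: (Hx n) (Hy n); case: (u n) => a c /= ? ?.
exact: lerD.
Qed.

End GeometricConvergence.

(** * Smooth germs *)

Section SmoothFunctions.
Variable K : numFieldType.
Implicit Types (f g : K * K -> K) (U V : set (K * K)) (k : nat).

Lemma open_slices U (p : K * K) : open U -> U p ->
  (\forall t \near p.1, U (t, p.2)) /\ (\forall t \near p.2, U (p.1, t)).
Proof.
move=> oU Up; have [[A B] /= [nA nB] AB] : nbhs p U by exact: open_nbhs_nbhs.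
split; first by apply: filterS nA => t At; apply: (AB (t, _)); split => //; exact: nbhs_singleton.
by apply: filterS nB => t Bt; apply: (AB (_, t)); split => //; exact: nbhs_singleton.
Qed.

Lemma dx_eq_on U f g : open U -> (forall p, U p -> f p = g p) ->
  forall p, U p -> dx f p = dx g p.
Proof.
move=> oU fg p Up; rewrite /dx !derive1E; apply: near_eq_derive.
by apply: filterS (proj1 (open_slices oU Up)) => t; exact: fg.
Qed.

Lemma dy_eq_on U f g : open U -> (forall p, U p -> f p = g p) ->
  forall p, U p -> dy f p = dy g p.
Proof.
move=> oU fg p Up; rewrite /dy !derive1E; apply: near_eq_derive.
by apply: filterS (proj2 (open_slices oU Up)) => t; exact: fg.
Qed.

(** Openness of [U] makes partial derivatives at its points depend on the values in [U] only;
    derivative formulas valid just on [U] can then be used inside [Ck]. *)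
Lemma eq_Ck k U f g : open U -> (forall p, U p -> f p = g p) -> Ck k U f -> Ck k U g.
Proof.
elim: k f g => [|k IH] f g oU fg [cf H]; split.
- move=> p Up; rewrite /prop_for /continuous_at -fg //.
  apply: cvg_trans (cf _ Up); apply: near_eq_cvg.
  by apply: filterS (open_nbhs_nbhs (conj oU Up)) => q; exact: fg.
- by [].
- move=> p Up; rewrite /prop_for /continuous_at -fg //.
  apply: cvg_trans (cf _ Up); apply: near_eq_cvg.
  by apply: filterS (open_nbhs_nbhs (conj oU Up)) => q; exact: fg.
- case: H => Dx Dy Hx Hy; split.
  + move=> p Up; apply: near_eq_derivable (Dx p Up).
    by apply: filterS (proj1 (open_slices oU Up)) => t; exact: fg.
  + move=> p Up; apply: near_eq_derivable (Dy p Up).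
    by apply: filterS (proj2 (open_slices oU Up)) => t; exact: fg.
  + by apply: IH Hx => //; exact: dx_eq_on.
  + by apply: IH Hy => //; exact: dy_eq_on.
Qed.

Lemma sub_Ck k U V f : (forall p, V p -> U p) -> Ck k U f -> Ck k V f.
Proof.
elim: k f => [|k IH] f VU [cf H]; split=> //; try by move=> p /VU; exact: cf.
case: H => Dx Dy Hx Hy; split.
- by move=> p /VU; exact: Dx.
- by move=> p /VU; exact: Dy.
- exact: IH.
- exact: IH.
Qed.

Lemma Ck_pred k U f : Ck k.+1 U f -> Ck k U f.
Proof.
elim: k f => [|k IH] f [cf H]; split=> //.
case: H => Dx Dy Hx Hy; split.
- exact: Dx.
- exact: Dy.
- exact: (IH _ Hx).
- exact: (IH _ Hy).
Qed.

Lemma Ck_lin k U f g (c : K) : open U -> Ck k U f -> Ck k U g ->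
  Ck k U (fun p => c * f p + g p).
Proof.
move=> oU; elim: k f g => [|k IH] f g [cf Hf] [cg Hg].
  split=> // p Up.
  by apply: cvgD; [apply: cvgM; [exact: cvg_cst | exact: cf] | exact: cg].
split=> [p Up|].
  by apply: cvgD; [apply: cvgM; [exact: cvg_cst | exact: cf] | exact: cg].
case: Hf => Dxf Dyf Hxf Hyf; case: Hg => Dxg Dyg Hxg Hyg; split.
- move=> p Up; apply: derivableD (Dxg p Up).
  by apply: derivableM (Dxf p Up); exact: derivable_cst.
- move=> p Up; apply: derivableD (Dyg p Up).
  by apply: derivableM (Dyf p Up); exact: derivable_cst.
- apply: eq_Ck oU _ (IH _ _ Hxf Hxg) => p Up; rewrite /dx !derive1E.
  have Dc : derivable (fun t : K => c * f (t, p.2)) p.1 1.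
    by apply: derivableM (Dxf p Up); exact: derivable_cst.
  apply/esym; rewrite (deriveD Dc (Dxg p Up)); congr (_ + _).
  exact: (deriveZ c (Dxf p Up)).
- apply: eq_Ck oU _ (IH _ _ Hyf Hyg) => p Up; rewrite /dy !derive1E.
  have Dc : derivable (fun t : K => c * f (p.1, t)) p.2 1.
    by apply: derivableM (Dyf p Up); exact: derivable_cst.
  apply/esym; rewrite (deriveD Dc (Dyg p Up)); congr (_ + _).
  exact: (deriveZ c (Dyf p Up)).
Qed.

Lemma Ck_cst k U (c : K) : open U -> Ck k U (cst c).
Proof.
move=> oU; elim: k c => [|k IH] c; split=> //; try by move=> p _; exact: cvg_cst.
split; try by move=> p _; exact: derivable_cst.
- by apply: eq_Ck oU _ (IH 0) => p _; rewrite /dx derive1E derive_cst.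
- by apply: eq_Ck oU _ (IH 0) => p _; rewrite /dy derive1E derive_cst.
Qed.

(** The x-derivative of x f is f + x f_x; its first summand is controlled by [Ck_pred], the second
    by induction. *)
Lemma Ck_mulx k U f : open U -> Ck k U f -> Ck k U (fun p => p.1 * f p).
Proof.
move=> oU; elim: k f => [|k IH] f.
  by move=> [cf _]; split=> // p Up; apply: cvgM; [exact: cvg_fst | exact: cf].
move=> H; have Hf := Ck_pred H; case: H => cf [Dx Dy Hx Hy]; split.
  by move=> p Up; apply: cvgM; [exact: cvg_fst | exact: cf].
split.
- by move=> p Up; apply: derivableM (Dx p Up); exact: derivable_id.
- by move=> p Up; apply: derivableM (Dy p Up); exact: derivable_cst.
- apply: eq_Ck oU _ (Ck_lin 1 oU Hf (IH _ Hx)) => -[x y] Up; rewrite /dx !derive1E /=.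
  apply/esym; rewrite (@deriveM _ _ id (fun t => f (t, y)) x 1 _ (Dx _ Up));
    last exact: derivable_id.
  rewrite derive_id addrC /= -[x *: _]/(x * _) -[f (x, y) *: _]/(f (x, y) * _).
  by rewrite mul1r mulr1.
- apply: eq_Ck oU _ (IH _ Hy) => -[x y] Up; rewrite /dy !derive1E /=.
  exact/esym/(deriveZ x (Dy _ Up)).
Qed.

Lemma cvg_swap (p : K * K) : swap q @[q --> p] --> swap p.
Proof.
case: p => x y Q [[A B] /= [nA nB] AB]; exists (B, A) => //.
by move=> [u v] [/= Bu Av]; exact: AB.
Qed.

Lemma Ck_swap k U f : Ck k U f -> Ck k (swap @^-1` U) (f \o swap).
Proof.
elim: k f => [|k IH] f [cf H]; split=> //.
- move=> p Up; apply: (cvg_comp _ _ (@cvg_swap p)); exact: cf.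
- move=> p Up; apply: (cvg_comp _ _ (@cvg_swap p)); exact: cf.
- case: H => Dx Dy Hx Hy; split.
  + by move=> p Up; exact: (Dy (swap p)).
  + by move=> p Up; exact: (Dx (swap p)).
  + exact: IH Hy.
  + exact: IH Hx.
Qed.

Lemma Ck_muly k U f : open U -> Ck k U f -> Ck k U (fun p => p.2 * f p).
Proof.
move=> oU /Ck_swap H.
have oV : open (swap @^-1` U).
  by apply: open_comp oU => p _; exact: cvg_swap.
have := Ck_swap (Ck_mulx oV H).
have -> : swap @^-1` (swap @^-1` U) = U by apply/seteqP; split=> -[].
by have -> : (fun p => p.1 * (f \o swap) p) \o swap = (fun p => p.2 * f p)
  by apply/funext => -[].
Qed.

End SmoothFunctions.

(** * Mean value inequality, chain rule and continuity from bounded partials *)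

Section RealCalculus.
Variable R : realType.
Implicit Types (F dF : R -> R) (f : R * R -> R).

Lemma mean_value_inequality F dF (c r M a b : R) :
  (forall s, `|s - c| < r -> is_derive s 1 F (dF s)) ->
  (forall s, `|s - c| < r -> `|dF s| <= M) ->
  `|a - c| < r -> `|b - c| < r -> `|F b - F a| <= M * `|b - a|.
Proof.
move=> D H; wlog ab : a b / a <= b => [hw|ac bc].
  have [|/ltW ba] := leP a b; first exact: hw.
  by move=> ac bc; rewrite distrC [X in _ * X]distrC; exact: hw.
have Hs s : s \in `[a, b] -> `|s - c| < r.
  by rewrite in_itv /= => /andP[a1 b1]; move: ac bc; rewrite !ltr_norml; lra.
have Dab s : s \in `]a, b[ -> is_derive s 1 F (dF s).
  by move=> sab; apply: D; apply: Hs; exact: subset_itv_oo_cc sab.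
have cF : {within `[a, b], continuous F}.
  apply: derivable_within_continuous => s sab.
  by have [] := D s (Hs _ sab).
have [s sab ->] := MVT_segment ab Dab cF.
by rewrite normrM ler_wpM2r // H // Hs.
Qed.

(** Clearing the difference quotient removes the division by s - t and admits s = t; in the chain
    rule the errors then simply add. *)
Lemma is_derive_eps F (t D : R) : is_derive t 1 F D -> forall e, 0 < e ->
  \forall s \near t, `|F s - F t - (s - t) * D| <= e * `|s - t|.
Proof.
move=> [cv <-] e e0; move: cv => /cvgrPdist_lt /(_ e e0) H.
move: H => /nbhs_normP[d /= d0 Hd].
apply/nbhs_normP; exists d => //= s sd.
have [->|st] := eqVneq s t; first by rewrite !subrr mul0r subr0 normr0 mulr0.
have st0 : s - t != 0 by rewrite subr_eq0.
have sd' : ball_ [eta Num.norm] 0 d (s - t) by rewrite /ball_ /= sub0r opprB.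
have := Hd (s - t) sd' st0.
rewrite -[X in `|_ - X|]/((s - t)^-1 * (F ((s - t) * 1 + t) - F t)) mulr1 subrK => h.
have -> : F s - F t - (s - t) * 'D_1 F t =
    - ((s - t) * ('D_1 F t - (s - t)^-1 * (F s - F t))).
  by rewrite [in RHS]mulrBr [_ * (_^-1 * _)]mulrA mulfV // mul1r opprB.
by rewrite normrN normrM [e * _]mulrC ler_wpM2l // ltW.
Qed.

Lemma eps_is_derive F (t D : R) :
  (forall e, 0 < e -> \forall s \near t, `|F s - F t - (s - t) * D| <= e * `|s - t|) ->
  is_derive t 1 F D.
Proof.
move=> H.
suff cv : h^-1 *: ((F \o shift t) (h *: (1 : R)) - F t) @[h --> 0^'] --> D.
  by apply: DeriveDef; [apply/cvg_ex; exists D | exact: cvg_lim].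
apply/cvgrPdist_le => e e0; move: (H e e0) => /nbhs_normP[d /= d0 Hd].
apply/nbhs_normP; exists d => //= h hd h0.
have := Hd (h + t); rewrite /= addrK opprD addrCA subrr addr0.
have hd' : `|- h| < d by move: hd; rewrite /= sub0r.
move=> /(_ hd') {}Hd.
rewrite -[X in `|_ - X|]/(h^-1 * (F (h * 1 + t) - F t)) mulr1.
have -> : D - h^-1 * (F (h + t) - F t) = - (h^-1 * (F (h + t) - F t - h * D)).
  by rewrite [in RHS]mulrBr [_ * (h * D)]mulrA mulVf // mul1r opprB.
by rewrite normrN normrM normfV ler_pdivrMl ?normr_gt0 // [`|h| * e]mulrC.
Qed.

Definition has_dx f (p : R * R) (D : R) : Prop :=
  is_derive (p.1 : R) (1 : R) (fun x : R => f (x, p.2)) D.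

Definition has_dy f (p : R * R) (D : R) : Prop :=
  is_derive (p.2 : R) (1 : R) (fun y : R => f (p.1, y)) D.

(** The increment is split at the corner (al t, be s): the move in x is controlled by the mean value
    inequality and continuity of [fx], the move in y by the one-variable chain rule. Each of three
    errors receives a third of [e]. *)
Lemma is_derive_curve f (fx fy : R * R -> R) (al be : R -> R) (t al' be' : R) :
  let q := (al t, be t) in
  (\forall p \near q, has_dx f p (fx p)) -> has_dy f q (fy q) ->
  {for q, continuous fx} ->
  is_derive t 1 al al' -> is_derive t 1 be be' ->
  is_derive t 1 (fun s => f (al s, be s)) (fx q * al' + fy q * be').
Proof.
move=> q Dx Dy cfx Dal Dbe; apply: eps_is_derive => e e0.
have cal : {for t, continuous al}.
  by apply: differentiable_continuous; apply/derivable1_diffP.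
have cbe : {for t, continuous be}.
  by apply: differentiable_continuous; apply/derivable1_diffP.
pose e1 := e / 3 / (`|al'| + 1); pose e2 := e / 3 / (`|fx q| + 1).
have e1_gt0 : 0 < e1 by rewrite !divr_gt0 // ltr_wpDl.
have e2_gt0 : 0 < e2 by rewrite !divr_gt0 // ltr_wpDl.
have [d /= d0 Hd] : exists2 d, 0 < d & forall u v, `|u - q.1| < d -> `|v - q.2| < d ->
    has_dx f (u, v) (fx (u, v)) /\ `|fx (u, v) - fx q| <= e1.
  have : \forall p \near q, has_dx f p (fx p) /\ `|fx p - fx q| <= e1.
    apply: filterI => //; move: cfx => /cvgrPdist_le /(_ e1 e1_gt0).
    by apply: filterS => p; rewrite distrC.
  move=> /nbhs_ballP[d /= d0 Hd]; exists d => // u v hu hv.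
  by apply: (Hd (u, v)); split; rewrite /ball /= distrC.
have Nal : \forall s \near t, `|al s - al t| < d.
  by move: cal => /cvgrPdist_lt /(_ d d0); apply: filterS => s; rewrite distrC.
have Nbe : \forall s \near t, `|be s - be t| < d.
  by move: cbe => /cvgrPdist_lt /(_ d d0); apply: filterS => s; rewrite distrC.
have E1 := is_derive_eps Dal ltr01.
have E2 := is_derive_eps Dal e2_gt0.
have e3_gt0 : 0 < e / 3 by rewrite divr_gt0.
have E3 := is_derive_eps (is_derive1_comp Dy Dbe) e3_gt0.
near=> s.
have nal : `|al s - al t| < d by near: s.
have nbe : `|be s - be t| < d by near: s.
have h1 : `|al s - al t - (s - t) * al'| <= 1 * `|s - t| by near: s.
have h2 : `|al s - al t - (s - t) * al'| <= e2 * `|s - t| by near: s.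
have h3 : `|f (al t, be s) - f (al t, be t) - (s - t) * (fy q * be')| <= e / 3 * `|s - t|.
  by near: s.
(* The mean value inequality is applied after subtracting the linear function with slope [fx q], so
   that the derivative is within [e1] of zero. *)
have h4 : `|f (al s, be s) - f (al t, be s) - fx q * (al s - al t)| <= e1 * `|al s - al t|.
  have := @mean_value_inequality (fun x => f (x, be s) - fx q * x)
    (fun x => fx (x, be s) - fx q) (al t) d e1 (al t) (al s).
  have -> : f (al s, be s) - fx q * al s - (f (al t, be s) - fx q * al t) =
    f (al s, be s) - f (al t, be s) - fx q * (al s - al t) by ring.
  apply=> // [x xd|x xd|].
  - have [Dfx _] := Hd x (be s) xd nbe.
    have Dm : is_derive x 1 (fun x => fx q * x) (fx q).
      by apply: is_derive_eq; rewrite scaler1.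
    exact: is_deriveB.
  - by have [_] := Hd x (be s) xd nbe.
  - by rewrite subrr normr0.
have h5 : `|al s - al t| <= (`|al'| + 1) * `|s - t|.
  have -> : al s - al t = (al s - al t - (s - t) * al') + (s - t) * al' by ring.
  rewrite (le_trans (ler_normD _ _)) // normrM.
  by move: h1; rewrite mul1r; lra.
have -> : f (al s, be s) - f (al t, be t) - (s - t) * (fx q * al' + fy q * be') =
   (f (al s, be s) - f (al t, be s) - fx q * (al s - al t)) +
   fx q * (al s - al t - (s - t) * al') +
   (f (al t, be s) - f (al t, be t) - (s - t) * (fy q * be')) by ring.
have b1 : `|f (al s, be s) - f (al t, be s) - fx q * (al s - al t)| <= e / 3 * `|s - t|.
  apply: (le_trans h4); apply: (le_trans (ler_wpM2l (ltW e1_gt0) h5)).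
  by rewrite mulrA /e1 divfK // gt_eqF // ltr_wpDl.
have b2 : `|fx q * (al s - al t - (s - t) * al')| <= e / 3 * `|s - t|.
  rewrite normrM; apply: (le_trans (ler_wpM2l (normr_ge0 _) h2)).
  rewrite mulrA ler_wpM2r // /e2 mulrCA ler_piMr ?(ltW e3_gt0) //.
  by rewrite ler_pdivrMr ?ltr_wpDl // mul1r lerDl.
have -> : e * `|s - t| = e / 3 * `|s - t| + e / 3 * `|s - t| + e / 3 * `|s - t| by field.
rewrite (le_trans (ler_normD _ _)) // lerD // (le_trans (ler_normD _ _)) // lerD //.
Unshelve. all: by end_near. Qed.

(** Bounded partials give a Lipschitz estimate along the two sides through the corner (p.1, q.2),
    which stays in the box. *)
Lemma partials_bounded_continuous f (fx fy : R * R -> R) (r M : R) (p : R * R) :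
  (forall q, `|q.1| < r -> `|q.2| < r ->
    [/\ has_dx f q (fx q), has_dy f q (fy q),
        `|fx q| <= M & `|fy q| <= M]) ->
  `|p.1| < r -> `|p.2| < r -> {for p, continuous f}.
Proof.
move=> H p1 p2; apply/cvgrPdist_le => e e0.
have M0 : 0 <= M by have [_ _ h _] := H p p1 p2; exact: le_trans h.
pose d := e / 2 / (M + 1); have d0 : 0 < d by rewrite !divr_gt0 // ltr_wpDl.
have N (x : R) (x0 : R) : `|x0| < r -> \forall x \near x0, `|x| < r /\ `|x0 - x| < d.
  move=> xr; apply: filterI; last by apply/nbhs_normP; exists d.
  apply/nbhs_normP; exists (r - `|x0|) => /=; first by rewrite subr_gt0.
  move=> y /= hy; have := ler_normB x0 (x0 - y); rewrite opprB addrC subrK; lra.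
have N1 := N 0 _ p1; have N2 := N 0 _ p2.
have : \forall q \near p, (`|q.1| < r /\ `|p.1 - q.1| < d) /\ (`|q.2| < r /\ `|p.2 - q.2| < d).
  by exists ([set x | `|x| < r /\ `|p.1 - x| < d], [set x | `|x| < r /\ `|p.2 - x| < d]).
apply: filterS => q [[q1 dq1] [q2 dq2]].
have h1 : `|f (p.1, q.2) - f (q.1, q.2)| <= M * `|p.1 - q.1|.
  apply: (@mean_value_inequality (fun x => f (x, q.2)) (fun x => fx (x, q.2)) 0 r).
  - by move=> s; rewrite subr0 => hs; have [] := H (s, q.2) hs q2.
  - by move=> s; rewrite subr0 => hs; have [] := H (s, q.2) hs q2.
  - by rewrite subr0.
  - by rewrite subr0.
have h2 : `|f (p.1, p.2) - f (p.1, q.2)| <= M * `|p.2 - q.2|.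
  apply: (@mean_value_inequality (fun y => f (p.1, y)) (fun y => fy (p.1, y)) 0 r).
  - by move=> s; rewrite subr0 => hs; have [] := H (p.1, s) p1 hs.
  - by move=> s; rewrite subr0 => hs; have [] := H (p.1, s) p1 hs.
  - by rewrite subr0.
  - by rewrite subr0.
have -> : f p - f q = (f (p.1, p.2) - f (p.1, q.2)) + (f (p.1, q.2) - f (q.1, q.2)).
  by rewrite addrA subrK; case: (p) (q) => [? ?] [? ?].
have Md : M * d <= e / 2.
  have e2 : 0 <= e / 2 by rewrite divr_ge0 // ltW.
  by rewrite /d mulrCA ler_piMr // ler_pdivrMr ?ltr_wpDl // mul1r lerDl.
rewrite (le_trans (ler_normD _ _)) //.
have := ler_wpM2l M0 (ltW dq1); have := ler_wpM2l M0 (ltW dq2); lra.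
Qed.

End RealCalculus.

(** * Integral averages along weighted dilations *)

Section WeightedAverage.
Variable R : realType.
Variable rho : R.
Implicit Types (f : R * R -> R) (p : R * R) (t : R) (w e : nat).

Local Notation mu := (@lebesgue_measure R).

Definition box (r : R) : set (R * R) := [set p | `|p.1| < r /\ `|p.2| < r].

Local Notation B := (box rho).

Definition smooth_on f := forall k, Ck k B f.

Lemma open_box r : open (box r).
Proof.
have O : open [set x : R | `|x| < r].
  by apply: (@open_comp _ _ (@Num.norm _ R) [set y | y < r]);
    [move=> x _; exact: norm_continuous | exact: open_lt].
have -> : box r = fst @^-1` [set x : R | `|x| < r] `&` snd @^-1` [set x : R | `|x| < r] by [].
apply: openI; apply: open_comp O => p _; [exact: cvg_fst | exact: cvg_snd].
Qed.

Lemma smooth_continuous f p : smooth_on f -> B p -> {for p, continuous f}.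
Proof. by move=> /(_ 0%N)[cf _]; exact: cf. Qed.

Lemma smooth_dx f : smooth_on f -> smooth_on (dx f).
Proof. by move=> sf k; have [_ [_ _ H _]] := sf k.+1. Qed.

Lemma smooth_dy f : smooth_on f -> smooth_on (dy f).
Proof. by move=> sf k; have [_ [_ _ _ H]] := sf k.+1. Qed.

Lemma smooth_has_dx f p : smooth_on f -> B p -> has_dx f p (dx f p).
Proof.
move=> sf Bp; have [_ [H _ _ _]] := sf 1%N.
by apply: DeriveDef; [exact: H | rewrite /dx derive1E].
Qed.

Lemma smooth_has_dy f p : smooth_on f -> B p -> has_dy f p (dy f p).
Proof.
move=> sf Bp; have [_ [_ H _ _]] := sf 1%N.
by apply: DeriveDef; [exact: H | rewrite /dy derive1E].
Qed.

Lemma smooth_swap f : smooth_on f -> smooth_on (f \o swap).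
Proof.
move=> sf k; have := Ck_swap (sf k).
by have -> : swap @^-1` B = B by apply/seteqP; split=> -[x y] [/= ? ?].
Qed.

Lemma box_swap r p : box r p -> box r (swap p).
Proof. by case: p => x y [/= ? ?]. Qed.

Definition scaling w1 w2 t p := (t ^+ w1 * p.1, t ^+ w2 * p.2).

Lemma box_scaling w1 w2 r t p : t \in `[0, 1] -> box r p -> box r (scaling w1 w2 t p).
Proof.
rewrite in_itv /= => /andP[t0 t1] [p1 p2].
have le w (x : R) : `|t ^+ w * x| <= `|x|.
  by rewrite normrM normrX (ger0_norm t0) ler_piMl // exprn_ile1.
by split; apply: le_lt_trans (le _ _) _.
Qed.

Lemma box_shrink p : B p -> exists2 r, r < rho & box r p.
Proof.
move=> [p1 p2]; exists ((Num.max `|p.1| `|p.2| + rho) / 2).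
  by rewrite ltr_pdivrMr // mulr_natr mulr2n ltrD2r gt_max p1 p2.
have m1 : `|p.1| <= Num.max `|p.1| `|p.2| by rewrite le_max lexx.
have m2 : `|p.2| <= Num.max `|p.1| `|p.2| by rewrite le_max lexx orbT.
have m3 : Num.max `|p.1| `|p.2| < rho by rewrite gt_max p1 p2.
by split; move: m1 m2 m3; lra.
Qed.

(** The radius is strictly smaller because [f] is only continuous on the open box; the closed
    smaller box is compact inside it. *)
Lemma bounded_on_box f r : (forall p, B p -> {for p, continuous f}) -> r < rho ->
  exists2 M, 0 <= M & forall p, box r p -> `|f p| <= M.
Proof.
move=> cf r_rho; pose A : set (R * R) := `[- r, r] `*` `[- r, r].
have AB p : A p -> B p.
  move=> [/=]; rewrite !in_itv /= => h1 h2.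
  by split; rewrite (le_lt_trans _ r_rho) // ler_norml.
have cA : compact A by apply: compact_setX; exact: segment_compact.
have : compact (f @` A).
  apply: continuous_compact cA; apply: continuous_in_subspaceT => p.
  by rewrite inE => /AB; exact: cf.
move/compact_bounded => [M [Mreal HM]].
exists (`|M| + 1); first by rewrite addr_ge0.
move=> p [p1 p2]; apply: (HM (`|M| + 1)).
  by rewrite (le_lt_trans (ler_norm M)) // ltrDl.
exists p => //; split; rewrite /= in_itv /= -ler_norml ltW //.
Qed.

Definition weighted_integrand w1 w2 e f p t := t ^+ e * f (scaling w1 w2 t p).

Lemma exprn_is_derive w t : is_derive t (1 : R) (fun s : R => s ^+ w) (w%:R * t ^+ w.-1).
Proof.
apply: DeriveDef; first exact: exprn_derivable.
by rewrite exp_derive -[LHS]/(w%:R * t ^+ w.-1 * 1) mulr1.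
Qed.

Lemma cvg_scaling w1 w2 t p : scaling w1 w2 s p @[s --> t] --> scaling w1 w2 t p.
Proof.
have H w (c : R) : s ^+ w * c @[s --> t] --> t ^+ w * c.
  by apply: cvgM; [exact: exprn_continuous | exact: cvg_cst].
exact: (cvg_pair (H w1 p.1) (H w2 p.2)).
Qed.

Lemma weighted_integrand_continuous w1 w2 e f p t :
  (forall q, B q -> {for q, continuous f}) -> B p -> t \in `[0, 1] ->
  {for t, continuous (weighted_integrand w1 w2 e f p)}.
Proof.
move=> cf Bp t01; apply: cvgM; first exact: exprn_continuous.
apply: (cvg_comp _ _ (@cvg_scaling w1 w2 t p)).
exact: cf (box_scaling w1 w2 t01 Bp).
Qed.

Lemma weighted_integrand_within w1 w2 e f p :
  (forall q, B q -> {for q, continuous f}) -> B p ->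
  {within `[0, 1], continuous (weighted_integrand w1 w2 e f p)}.
Proof.
move=> cf Bp; apply: continuous_in_subspaceT => t; rewrite inE /= => t01.
exact: weighted_integrand_continuous.
Qed.

Lemma weighted_integrand_integrable w1 w2 e f p :
  (forall q, B q -> {for q, continuous f}) -> B p ->
  mu.-integrable `[0, 1] (EFin \o weighted_integrand w1 w2 e f p).
Proof.
move=> cf Bp; apply: continuous_compact_integrable; first exact: segment_compact.
exact: weighted_integrand_within.
Qed.

Definition weighted_average w1 w2 e f p : R :=
  \int[mu]_(t in `[0, 1]) weighted_integrand w1 w2 e f p t.

Lemma integrable_cst01 (M : R) : mu.-integrable `[0, 1] (EFin \o cst M).
Proof.
apply: continuous_compact_integrable; first exact: segment_compact.
by apply: continuous_subspaceT => x; exact: cvg_cst.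
Qed.

Lemma weighted_average_bound w1 w2 e f r M p :
  (forall q, B q -> {for q, continuous f}) -> r <= rho ->
  (forall q, box r q -> `|f q| <= M) -> box r p ->
  `|weighted_average w1 w2 e f p| <= M.
Proof.
move=> cf r_rho fM rp.
have Bp : B p by case: rp => ? ?; split; apply: lt_le_trans r_rho.
have int := weighted_integrand_integrable w1 w2 e cf Bp.
apply: (le_trans (le_normr_Rintegral _ int)); first exact: measurable_itv.
have -> : M = \int[mu]_(t in `[0, 1]) cst M t.
  have mu01 : mu `[0 : R, 1]%classic = 1%E.
    by rewrite lebesgue_measure_itv /= lte_fin ltr01 oppr0 adde0.
  by rewrite Rintegral_cst // [X in fine X]mu01 mulr1.
apply: le_Rintegral => //.
- exact: integrable_norm.
- exact: integrable_cst01.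
move=> t /= t01; rewrite /weighted_integrand normrM normrX.
have := t01; rewrite in_itv /= => /andP[t0 t1].
apply: (@le_trans _ _ `|f (scaling w1 w2 t p)|).
  by rewrite ler_piMl // exprn_ile1 // ger0_norm.
exact/fM/box_scaling.
Qed.

Lemma weighted_integrand_dx w1 w2 e f p t : smooth_on f -> B p -> t \in `[0, 1] ->
  has_dx (fun q => weighted_integrand w1 w2 e f q t) p
    (weighted_integrand w1 w2 (e + w1) (dx f) p t).
Proof.
move=> sf Bp t01; have Df := smooth_has_dx sf (box_scaling w1 w2 t01 Bp).
have Dg : is_derive p.1 (1 : R) (fun x : R => t ^+ w1 * x) (t ^+ w1).
  have := is_deriveZ (t ^+ w1) (is_derive_id p.1 (1 : R)).
  by rewrite -[X in is_derive _ _ _ X]/(t ^+ w1 * 1) mulr1.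
have := is_deriveZ (t ^+ e) (is_derive1_comp Df Dg).
rewrite -[X in is_derive _ _ _ X]/(t ^+ e * (dx f (scaling w1 w2 t p) * t ^+ w1)).
by rewrite mulrCA -exprD mulrC.
Qed.

(** Differentiation under the integral sign. On a smaller box the bound of f_x dominates for all t,
    since dilations with t in [0, 1] preserve the box and powers of t are at most 1. *)
Lemma weighted_average_dx w1 w2 e f p : smooth_on f -> B p ->
  has_dx (weighted_average w1 w2 e f) p (weighted_average w1 w2 (e + w1) (dx f) p).
Proof.
case: p => x y sf Bp; have [r r_rho [/= xr yr]] := box_shrink Bp.
pose F (x' t : R) := weighted_integrand w1 w2 e f (x', y) t.
have rx x' : `]- r, r[%classic x' -> box r (x', y).
  by rewrite /= in_itv /= -ltr_norml.
have Bx x' : `]- r, r[%classic x' -> B (x', y).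
  by move=> /rx[? ?]; split; exact: lt_trans r_rho.
have cf q : B q -> {for q, continuous f} by exact: smooth_continuous.
have cdf q : B q -> {for q, continuous (dx f)} by exact/smooth_continuous/smooth_dx.
have [M M0 HM] := bounded_on_box cdf r_rho.
have DF x' t : `]- r, r[%classic x' -> `[0, 1]%classic t ->
    is_derive x' 1 (F ^~ t) (weighted_integrand w1 w2 (e + w1) (dx f) (x', y) t).
  by move=> Ix t01; exact: (weighted_integrand_dx w1 w2 e sf (Bx _ Ix) t01).
have pF x' t : `]- r, r[%classic x' -> `[0, 1]%classic t ->
    partial1of2 F x' t = weighted_integrand w1 w2 (e + w1) (dx f) (x', y) t.
  by move=> Ix t01; rewrite partial1of2E; have [] := DF x' t Ix t01.
have m01 : @measurable _ (measurableTypeR R) `[0, 1]%classic by exact: measurable_itv.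
have Ix : `]- r, r[%classic x by rewrite /= in_itv /= -ltr_norml.
have intF x' : `]- r, r[%classic x' -> mu.-integrable `[0, 1] (EFin \o F x').
  by move=> /Bx; exact: weighted_integrand_integrable.
have derF x' t : `]- r, r[%classic x' -> `[0, 1]%classic t -> derivable (F ^~ t) x' 1.
  by move=> Ix' t01; have [] := DF x' t Ix' t01.
have bF x' t : `]- r, r[%classic x' -> `[0, 1]%classic t -> `|partial1of2 F x' t| <= cst M t.
  move=> Ix' t01; rewrite pF // /weighted_integrand normrM normrX.
  have := t01; rewrite /= in_itv /= => /andP[t0 t1].
  apply: (@le_trans _ _ `|dx f (scaling w1 w2 t (x', y))|).
    by rewrite ler_piMl // exprn_ile1 // ger0_norm.
  exact/HM/box_scaling/rx.
have D := derivable_under_integral m01 Ix intF derF (fun=> M0) (integrable_cst01 M) bF.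
have E := differentiation_under_integral m01 Ix intF derF (fun=> M0) (integrable_cst01 M) bF.
apply: DeriveDef; first exact: D.
rewrite -derive1E; apply: etrans E _; apply: eq_Rintegral => t.
by rewrite inE => t01; exact: pF.
Qed.

Lemma weighted_average_dy w1 w2 e f p : smooth_on f -> B p ->
  has_dy (weighted_average w1 w2 e f) p (weighted_average w1 w2 (e + w2) (dy f) p).
Proof.
by move=> sf Bp; exact: (weighted_average_dx w2 w1 e (smooth_swap sf) (box_swap Bp)).
Qed.

Lemma weighted_average_continuous w1 w2 e f p : smooth_on f -> B p ->
  {for p, continuous (weighted_average w1 w2 e f)}.
Proof.
move=> sf Bp; have [r r_rho rp] := box_shrink Bp.
have cx q : B q -> {for q, continuous (dx f)} by exact/smooth_continuous/smooth_dx.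
have cy q : B q -> {for q, continuous (dy f)} by exact/smooth_continuous/smooth_dy.
have [Mx Mx0 Hx] := bounded_on_box cx r_rho.
have [My My0 Hy] := bounded_on_box cy r_rho.
apply: (@partials_bounded_continuous _ _ (weighted_average w1 w2 (e + w1) (dx f))
  (weighted_average w1 w2 (e + w2) (dy f)) r (Mx + My)); try by case: rp.
move=> q q1 q2; have rq : box r q by [].
have Bq : B q by split; exact: lt_trans r_rho.
split.
- exact: weighted_average_dx.
- exact: weighted_average_dy.
- apply: (weighted_average_bound _ _ _ cx (ltW r_rho)) rq => s /Hx h.
  by rewrite (le_trans h) // lerDl.
- apply: (weighted_average_bound _ _ _ cy (ltW r_rho)) rq => s /Hy h.
  by rewrite (le_trans h) // lerDr.
Qed.

Lemma dx_weighted_average w1 w2 e f p : smooth_on f -> B p ->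
  dx (weighted_average w1 w2 e f) p = weighted_average w1 w2 (e + w1) (dx f) p.
Proof.
by move=> sf Bp; rewrite /dx derive1E; have [] := weighted_average_dx w1 w2 e sf Bp.
Qed.

Lemma dy_weighted_average w1 w2 e f p : smooth_on f -> B p ->
  dy (weighted_average w1 w2 e f) p = weighted_average w1 w2 (e + w2) (dy f) p.
Proof.
by move=> sf Bp; rewrite /dy derive1E; have [] := weighted_average_dy w1 w2 e sf Bp.
Qed.

(** The averages form a family stable under differentiation: the pair (e, f) becomes (e + w1, f_x)
    or (e + w2, f_y). The induction therefore varies [e] and [f]. *)
Lemma weighted_average_smooth w1 w2 e f :
  smooth_on f -> smooth_on (weighted_average w1 w2 e f).
Proof.
move=> sf k; elim: k e f sf => [|k IH] e f sf; split=> //;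
  try by move=> p Bp; exact: weighted_average_continuous.
split.
- by move=> p Bp; have [] := weighted_average_dx w1 w2 e sf Bp.
- by move=> p Bp; have [] := weighted_average_dy w1 w2 e sf Bp.
- have Ex p : B p -> weighted_average w1 w2 (e + w1) (dx f) p = dx (weighted_average w1 w2 e f) p.
    by move=> Bp; rewrite dx_weighted_average.
  exact: (eq_Ck (@open_box rho) Ex (IH (e + w1)%N _ (smooth_dx sf))).
- have Ex p : B p -> weighted_average w1 w2 (e + w2) (dy f) p = dy (weighted_average w1 w2 e f) p.
    by move=> Bp; rewrite dy_weighted_average.
  exact: (eq_Ck (@open_box rho) Ex (IH (e + w2)%N _ (smooth_dy sf))).
Qed.

(* The fundamental theorem of calculus for t |-> t ^ m f (t ^ w1 x, t ^ w2 y). *)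
Lemma weighted_average_FTC w1 w2 m f p : (0 < w1)%N -> (0 < w2)%N ->
  smooth_on f -> B p ->
  m%:R * weighted_average w1 w2 m.-1 f p +
  (w1%:R * (p.1 * weighted_average w1 w2 (m + w1.-1) (dx f) p) +
   w2%:R * (p.2 * weighted_average w1 w2 (m + w2.-1) (dy f) p)) =
  f p - 0 ^+ m * f (0, 0).
Proof.
move=> w1_gt0 w2_gt0 sf Bp.
have cf q : B q -> {for q, continuous f} by exact: smooth_continuous.
have cx q : B q -> {for q, continuous (dx f)} by exact/smooth_continuous/smooth_dx.
have cy q : B q -> {for q, continuous (dy f)} by exact/smooth_continuous/smooth_dy.
pose phi := weighted_integrand w1 w2 m f p.
pose g0 := weighted_integrand w1 w2 m.-1 f p.
pose g1 := weighted_integrand w1 w2 (m + w1.-1) (dx f) p.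
pose g2 := weighted_integrand w1 w2 (m + w2.-1) (dy f) p.
pose dphi (t : R) := m%:R * g0 t + (w1%:R * p.1 * g1 t + w2%:R * p.2 * g2 t).
have Dphi t : t \in `[0, 1] -> is_derive t 1 phi (dphi t).
  move=> t01; pose q := scaling w1 w2 t p.
  have Bq : B q by exact: box_scaling.
  have Dal w (c : R) : is_derive t 1 (fun s : R => s ^+ w * c) (w%:R * t ^+ w.-1 * c).
    have -> : (fun s : R => s ^+ w * c) = c \*: (fun s : R => s ^+ w).
      by apply/funext => s; rewrite mulrC.
    by rewrite mulrC; exact: is_deriveZ (exprn_is_derive w t).
  have Nq : \forall p \near q, has_dx f p (dx f p).
    by apply: filterS (open_nbhs_nbhs (conj (@open_box rho) Bq)) => p' ; exact: smooth_has_dx.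
  have Dc := @is_derive_curve R f (dx f) (dy f) (fun s => s ^+ w1 * p.1)
    (fun s => s ^+ w2 * p.2) t _ _ Nq (smooth_has_dy sf Bq)
    (cx _ Bq) (Dal w1 p.1) (Dal w2 p.2).
  (* Predecessors at zero are harmless: the exponent [m.-1] comes with the factor [m], and the
     weights are positive. *)
  have -> : dphi t = t ^+ m * (dx f q * (w1%:R * t ^+ w1.-1 * p.1) +
      dy f q * (w2%:R * t ^+ w2.-1 * p.2)) + f q * (m%:R * t ^+ m.-1).
    by rewrite /dphi /g0 /g1 /g2 /weighted_integrand -/q !exprD; ring.
  exact: (is_deriveM (exprn_is_derive m t) Dc).
have cdphi : {within `[0, 1], continuous dphi}.
  apply: continuous_in_subspaceT => t; rewrite inE /= => t01.
  have H (c : R) e g : (forall q, B q -> {for q, continuous g}) ->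
      {for t, continuous (fun s => c * weighted_integrand w1 w2 e g p s)}.
    by move=> cg; apply: cvgM; [exact: cvg_cst | exact: weighted_integrand_continuous].
  exact: cvgD (H _ _ _ cf) (cvgD (H _ _ _ cx) (H _ _ _ cy)).
have cphi t : t \in `[0, 1] -> {for t, continuous phi}.
  by move=> t01; exact: weighted_integrand_continuous.
have LR : derivable_oo_LRcontinuous phi 0 1.
  split=> [t t01||].
  - by have [] := Dphi t (subset_itv_oo_cc t01).
  - by apply: cvg_at_right_filter; apply: cphi; rewrite in_itv /= lexx ler01.
  - by apply: cvg_at_left_filter; apply: cphi; rewrite in_itv /= lexx ler01.
have Ephi : {in `]0, 1[, phi^`()%classic =1 dphi}.
  by move=> t t01; rewrite derive1E; have [] := Dphi t (subset_itv_oo_cc t01).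
have FTC := continuous_FTC2 ltr01 cdphi LR Ephi.
have m01 : @measurable _ (measurableTypeR R) `[0, 1]%classic by exact: measurable_itv.
have i0 := weighted_integrand_integrable w1 w2 m.-1 cf Bp.
have i1 := weighted_integrand_integrable w1 w2 (m + w1.-1) cx Bp.
have i2 := weighted_integrand_integrable w1 w2 (m + w2.-1) cy Bp.
(* At t = 0 the dilation collapses to the origin, the weights being positive. The factor 0^m is 1
   for m = 0, which yields Hadamard's lemma, and 0 for m = n + 1, which inverts W + n + 1. *)
have -> : f p - 0 ^+ m * f (0, 0) = phi 1 - phi 0.
  rewrite /phi /weighted_integrand /scaling !expr1n !mul1r !expr0n.
  by rewrite (gtn_eqF w1_gt0) (gtn_eqF w2_gt0) !mul0r; case: (p).
have -> : phi 1 - phi 0 = \int[mu]_(t in `[0, 1]) dphi t by rewrite /Rintegral FTC.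
have iZ (c : R) g : mu.-integrable `[0, 1] (EFin \o g) ->
    mu.-integrable `[0, 1] (EFin \o (fun t => c * g t)).
  exact: (integrableZl m01 c).
have iD := integrableD m01 (iZ (w1%:R * p.1) _ i1) (iZ (w2%:R * p.2) _ i2).
rewrite (RintegralD m01 (iZ m%:R _ i0) iD) (RintegralD m01 (iZ _ _ i1) (iZ _ _ i2)).
by rewrite (RintegralZl _ m01 i0) (RintegralZl _ m01 i1) (RintegralZl _ m01 i2) !mulrA.
Qed.

End WeightedAverage.

(** * Smooth germs form a regular class *)

Section SmoothClass.
Variable R : realType.

Lemma smooth0P (f : R * R -> R) : smooth0 f <-> exists2 rho, 0 < rho & smooth_on rho f.
Proof.
split=> [[U [oU U0] H]|[rho rho0 H]].
  have [rho /= rho0 Hr] : exists2 rho : R, 0 < rho & forall p, box rho p -> U p.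
    have /nbhs_ballP[rho /= rho0 Hr] := open_nbhs_nbhs (conj oU U0).
    exists rho => // p [p1 p2]; apply: Hr.
    by split; rewrite /ball /= sub0r normrN.
  by exists rho => // k; exact: sub_Ck (H k).
exists (box rho) => //; split; first exact: open_box.
by split; rewrite /= normr0.
Qed.

Lemma smooth_on_lin rho (c : R) f g :
  smooth_on rho f -> smooth_on rho g -> smooth_on rho (fun p => c * f p + g p).
Proof. by move=> sf sg k; exact: Ck_lin (@open_box _ rho) (sf k) (sg k). Qed.

Lemma smooth_on_le (rho rho' : R) f : rho' <= rho -> smooth_on rho f -> smooth_on rho' f.
Proof.
by move=> le sf k; apply: sub_Ck (sf k) => p [p1 p2]; split; exact: lt_le_trans le.
Qed.

Lemma smooth_on_cst rho (c : R) : smooth_on rho (cst c).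
Proof. by move=> k; exact: Ck_cst (@open_box _ rho). Qed.

Lemma smooth_on_scale rho (c : R) f : smooth_on rho f -> smooth_on rho (fun p => c * f p).
Proof.
move=> sf; have := smooth_on_lin c sf (smooth_on_cst rho 0).
by have -> : (fun p => c * f p + cst 0 p) = (fun p => c * f p)
  by apply/funext => p; rewrite addr0.
Qed.

Lemma smooth_regular_class (w1 w2 : nat) : (0 < w1)%N -> (0 < w2)%N ->
  regular_class w1 w2 (@germ_of R @` @smooth0 R).
Proof.
move=> w1_gt0 w2_gt0; split.
- move=> c _ _ [f /smooth0P[r r0 sf] <-] [g /smooth0P[r' r0' sg] <-].
  exists (fun p => c * f p + g p); last by rewrite -germ_ofZ -germ_ofD.
  apply/smooth0P; exists (Num.min r r'); first by rewrite lt_min r0.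
  by apply: smooth_on_lin; [apply: smooth_on_le sf | apply: smooth_on_le sg];
    rewrite ge_min lexx ?orbT.
- exists (cst 1); last exact: germ_of1.
  by apply/smooth0P; exists 1 => //; exact: smooth_on_cst.
- move=> _ [f /smooth0P[r r0 sf] <-]; exists (fun p => p.1 * f p); last by rewrite -germ_ofM.
  by apply/smooth0P; exists r => // k; exact: Ck_mulx (@open_box _ r) (sf k).
- move=> _ [f /smooth0P[r r0 sf] <-]; exists (fun p => p.2 * f p); last by rewrite -germ_ofM.
  by apply/smooth0P; exists r => // k; exact: Ck_muly (@open_box _ r) (sf k).
- move=> _ [f /smooth0P[r r0 sf] <-]; apply/gderivableP.
  apply: filterS (near0_box r0) => p Bp.
  have [Dx _] := smooth_has_dx sf Bp; have [Dy _] := smooth_has_dy sf Bp.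
  exact: conj Dx Dy.
- move=> _ [f /smooth0P[r r0 sf] <-]; rewrite ddx_germ_of; exists (dx f) => //.
  by apply/smooth0P; exists r => //; exact: smooth_dx.
- move=> _ [f /smooth0P[r r0 sf] <-]; rewrite ddy_germ_of; exists (dy f) => //.
  by apply/smooth0P; exists r => //; exact: smooth_dy.
- move=> _ [f /smooth0P[r r0 sf] <-].
  (* The two Hadamard quotients are the coefficients of x and y in the fundamental theorem with m =
     0. *)
  pose g p := w1%:R * weighted_average w1 w2 w1.-1 (dx f) p.
  pose g' p := w2%:R * weighted_average w1 w2 w2.-1 (dy f) p.
  exists (f (0, 0)), (germ_of g), (germ_of g'); split.
  + exists g => //; apply/smooth0P; exists r => //.
    exact/smooth_on_scale/weighted_average_smooth/smooth_dx.
  + exists g' => //; apply/smooth0P; exists r => //.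
    exact/smooth_on_scale/weighted_average_smooth/smooth_dy.
  rewrite scale_germE mulr1 -!germ_ofM -!germ_ofD; apply/germ_ofP.
  apply: filterS (near0_box r0) => p Bp.
  have E := weighted_average_FTC 0 w1_gt0 w2_gt0 sf Bp.
  rewrite mul0r add0r expr0 mul1r !add0n in E.
  rewrite -[LHS](subrK (f (0, 0))) -E addrC.
  by congr (_ + (_ + _)); exact: mulrCA.
- move=> n _ [f /smooth0P[r r0 sf] <-].
  pose h := weighted_average w1 w2 n f.
  have Sh : smooth0 h.
    by apply/smooth0P; exists r => //; exact: weighted_average_smooth.
  exists (germ_of h); first by exists h.
  rewrite ddx_germ_of ddy_germ_of -!germ_ofM -!germ_ofZ -!germ_ofD.
  apply/germ_ofP; apply: filterS (near0_box r0) => p Bp.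
  have := weighted_average_FTC n.+1 w1_gt0 w2_gt0 sf Bp.
  rewrite expr0n mul0r subr0 => <-.
  rewrite -[LHS]/(w1%:R * (p.1 * dx h p) + w2%:R * (p.2 * dy h p) + n.+1%:R * h p).
  rewrite (dx_weighted_average w1 w2 n sf Bp) (dy_weighted_average w1 w2 n sf Bp) addrC.
  (* For m = n + 1 the exponents m + w1 - 1 and m + w2 - 1 are n + w1 and n + w2, as in the partials
     of [h]. *)
  by rewrite !addSn -!addnS !prednK.
Qed.

End SmoothClass.

Theorem theorem4p9 (R : realType) (C : category) (w1 w2 : nat) (d : int)
    (f : mpoly.mpoly 2 (base R C)) (c r : nat)
    (e : 'I_r -> mpoly.mpoly 2 (base R C)) (m : 'I_c -> mpoly.multinom 2) :
  (0 < w1)%N -> (0 < w2)%N ->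
  quasi_homogeneous w1 w2 d f ->
  has_codim C (poly_germ f) c ->
  is_basis (quasi_homogeneous w1 w2 (d - w1%:Z - w2%:Z)) e ->
  quot_basis (regular_germs R C) (jacobian_ideal C (poly_germ f))
    (fun j => poly_germ (monomial (base R C) (m j))) ->
  quot_basis (regular_germs R C) (B2 C (poly_germ f))
    (fun k : 'I_(r + c) =>
       match fintype.split k with
       | inl i => poly_germ (e i * f)
       | inr j => poly_germ (monomial (base R C) (m j))
       end) /\
  quot_dim (bivectors R C) (coboundaries2 C (wedge (poly_germ f))) (r + c).
Proof.
move=> w1_gt0 w2_gt0 /quasi_homogeneousP f_whomog _ e_basis m_basis.
have RS : regular_class w1 w2 (regular_germs R C).
  case: C {f e f_whomog e_basis m_basis}.
  - exact: analytic_complex_regular_class.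
  - exact: analytic_real_regular_class.
  - exact: smooth_regular_class.
have main := boundaries_basis w1_gt0 w2_gt0 RS f_whomog m_basis e_basis.
split; first exact: main.
(* A bivector is represented by its coefficient, so [wedge] is the identity and the Schouten
   coboundaries are [B2] by conversion. *)
have E : bivectors R C = regular_germs R C by exact: image_id.
by rewrite E; eexists; exact: main.
Qed.
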